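(* Let $(X_n,\|\cdot\|_n)_{n\in\mathbb{N}}$ be a sequence of separable Banach spaces, and let $\tilde X$ be the $\left(\mathcal{A}_{n_i},\frac1{m_i}\right)^{\sigma}$-$d$-product of the sequence $(X_n,\|\cdot\|_n)_{n\in\mathbb{N}}$. Then $\tilde X$ is a block-H.I. space, i.e. every block subspace of $\tilde X$ is a hereditarily indecomposable Banach space.
   Context: H.I.: A Banach space $Z$ is hereditarily indecomposable (H.I.) if for any infinite dimensional closed subspaces $Y_1,Y_2$ of $Z$ and any $\varepsilon>0$ there exist $y_1\in Y_1$, $y_2\in Y_2$ with $\|y_1-y_2\|<\varepsilon\|y_1+y_2\|$. Parameters: $(m_i)_{i\ge1}$, $(n_i)_{i\ge1}$ are sequences of natural numbers with $m_1=2$, $m_{i+1}\ge m_i^5$, $n_1=3$, $n_{i+1}=n_i^{s_i}$, where $s_i$ is an integer with $2^{s_i}>m_{i+1}^3$. $\mathcal{A}_n=\{F\subset\mathbb{N}:|F|\le n\}$. Vectors: $\Omega_{00}=\left(\prod_{n=1}^\infty X_n\right)_{00}$ is the space of finitely supported elements of $\prod_n X_n$, where the support of $\tilde x$ is $\{n:\tilde x(n)\neq0\}$. For finite non-empty $A,B\subset\mathbb{N}$, $A<B$ means $\max A<\min B$; for non-zero finitely supported $\tilde x,\tilde y$, $\tilde x<\tilde y$ means $\operatorname{supp}\tilde x<\operatorname{supp}\tilde y$ (similarly for functionals). A block sequence is a sequence $(\tilde x_k)_{k\in\mathbb{N}}$ of non-zero vectors of $\Omega_{00}$ with $\tilde x_k<\tilde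 x_{k+1}$; a block subspace is the closed linear span of a block sequence. Each $f=(f_n)_n$ finitely supported with $f_n\in X_n^*$ acts by $f(\tilde x)=\sum_n f_n(\tilde x(n))$; $X_n^*$ is identified with functionals supported at $n$. The set $K$: For each $n$ fix a countable symmetric set $\mathcal{F}_n\subset B_{X_n^*}$ with $\|x\|_n=\sup_{f\in\mathcal{F}_n}f(x)$ for all $x\in X_n$. Let $K$ be the smallest set of finitely supported functionals which contains $\bigcup_n\mathcal{F}_n$ and is such that for every $i$, whenever $f_1<\dots<f_d$ are in $K$ and $d\le n_i$, then $\frac1{m_i}(f_1+\dots+f_d)\in K$. Let $A_0^*=\bigcup_n\mathcal{F}_n$ and, for $i\ge1$, $A_i^*=\{\frac1{m_i}(f_1+\dots+f_d): d\le n_i,\ f_1<\dots<f_d,\ f_k\in K\}$. For non-zero $f\in K$ put $j(f)=\max\{i:f\in A_i^*\}$. Coding: let $\mathcal{K}=\{(f_1,\dots,f_d):d\in\mathbb{N},\ f_1<\dots<f_d,\ f_i\in K\}$ (a countable set), and fix an injective function $\sigma:\mathcal{K}\to\{2j:j\in\mathbb{N}\}$ with $\sigma(f)>j(f)$ for $f\in K$ and $\sigma(f_1,\dots,f_n)<\sigma(f_1,\dots,f_n,f_{n+1})$ whenever $(f_1,\dots,f_{n+1})\in\mathcal{K}$. The set $L$: $L^0=\bigcup_n\mathcal{F}_n$ and $L_i^0=\emptyset$ for all $i$. For $s\ge1$: $L_{2j}^s=\pm L_{2j}^{s-1}\cup\{\frac1{m_{2j}}(f_1+\dots+f_d):d\le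 n_{2j},\ f_1<\dots<f_d,\ f_k\in L^{s-1}\}$; $L_{2j+1}'^{\,s}=\pm L_{2j+1}^{s-1}\cup\{\frac1{m_{2j+1}}(f_1+\dots+f_d):d\le n_{2j+1},\ f_1<\dots<f_d,\ f_k\in L^{s-1},\ f_1\in L_{2k}^{s-1}\text{ for some }k>n_{2j+1},\ f_{i+1}\in L^{s-1}_{\sigma(f_1,\dots,f_i)}\text{ for }1\le i<d\}$; $L_{2j+1}^s=\{f|_{[k,+\infty)}:f\in L_{2j+1}'^{\,s},\ k\in\mathbb{N}\}$, where $f|_{[k,+\infty)}$ is obtained from $f$ by setting its coordinates with index $<k$ to $0$; $L^s=L^{s-1}\cup\bigcup_{i}L_i^s$. Finally $L=\bigcup_{s\ge0}L^s$. The $\left(\mathcal{A}_{n_i},\frac1{m_i}\right)^\sigma$-$d$-product of $(X_n)$ is the completion $\tilde X$ of $\Omega_{00}$ under the norm $\|\tilde x\|_L=\sup_{f\in L}f(\tilde x)$. *)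

(* Defs.v *)
From HB Require Import structures.
From mathcomp Require Import all_boot all_order all_algebra.
From mathcomp Require Import all_classical all_reals all_analysis.

Set Implicit Arguments.
Unset Strict Implicit.
Unset Printing Implicit Defensive.

Import Order.TTheory GRing.Theory Num.Theory.
Import numFieldNormedType.Exports.

Local Open Scope classical_set_scope.
Local Open Scope ring_scope.

(* Coordinates are indexed by nat = {0, 1, ...}; only the order of the
   coordinates matters.  The indices i of m_i, n_i, A_i^*, L_i start from 1,
   and the entries m 0, n 0 are never used. *)

Section Product.
Context {R : realType}.
Implicit Type E : nat -> lmodType R.

Definition dprod E := forall n, E n.

HB.instance Definition _ E := gen_eqMixin (dprod E).
HB.instance Definition _ E := gen_choiceMixin (dprod E).

Section Structure.
Variable E : nat -> lmodType R.
Implicit Types x y z : dprod E.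

Definition dprod_zero : dprod E := fun n => 0.
Definition dprod_opp x : dprod E := fun n => - x n.
Definition dprod_add x y : dprod E := fun n => x n + y n.
Definition dprod_scale (a : R) x : dprod E := fun n => a *: x n.

Fact dprod_addA : associative dprod_add.
Proof. by move=> x y z; apply: functional_extensionality_dep => n; exact: addrA. Qed.
Fact dprod_addC : commutative dprod_add.
Proof. by move=> x y; apply: functional_extensionality_dep => n; exact: addrC. Qed.
Fact dprod_add0 : left_id dprod_zero dprod_add.
Proof. by move=> x; apply: functional_extensionality_dep => n; exact: add0r. Qed.
Fact dprod_addN : left_inverse dprod_zero dprod_opp dprod_add.
Proof. by move=> x; apply: functional_extensionality_dep => n; exact: addNr. Qed.

HB.instance Definition _ := GRing.isZmodule.Build (dprod E)
  dprod_addA dprod_addC dprod_add0 dprod_addN.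

Fact dprod_scaleA a b x :
  dprod_scale a (dprod_scale b x) = dprod_scale (a * b) x.
Proof. by apply: functional_extensionality_dep => n; exact: scalerA. Qed.
Fact dprod_scale1 : left_id 1 dprod_scale.
Proof. by move=> x; apply: functional_extensionality_dep => n; exact: scale1r. Qed.
Fact dprod_scaleDr : right_distributive dprod_scale +%R.
Proof. by move=> a x y; apply: functional_extensionality_dep => n; exact: scalerDr. Qed.
Fact dprod_scaleDl x : {morph dprod_scale^~ x : a b / a + b}.
Proof. by move=> a b; apply: functional_extensionality_dep => n; exact: scalerDl. Qed.

HB.instance Definition _ := GRing.Zmodule_isLmodule.Build R (dprod E)
  dprod_scaleA dprod_scale1 dprod_scaleDr dprod_scaleDl.

Definition dsupp x : set nat := [set n | x n != 0].

Definition finsupp : {pred dprod E} := [pred x | `[< finite_set (dsupp x) >]].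

Fact finsupp_submod : submod_closed finsupp.
Proof.
split=> [|a x y /asboolP fx /asboolP fy]; apply/asboolP.
  apply: (sub_finite_set _ (finite_set0 nat)) => n /=.
  by rewrite /dsupp /= eqxx.
have fU : finite_set (dsupp x `|` dsupp y) by rewrite finite_setU.
apply: sub_finite_set fU => n; rewrite /dsupp /=.
have [x0|] := eqVneq (x n) 0; last by left.
have [y0|] := eqVneq (y n) 0; last by right.
have -> : (a *: x + y) n = a *: x n + y n by [].
by rewrite x0 y0 scaler0 addr0 eqxx.
Qed.

HB.instance Definition _ :=
  GRing.isSubmodClosed.Build R (dprod E) finsupp finsupp_submod.

(* (prod_n E_n)_00 *)
Record c00 := C00 { c00_val :> dprod E; _ : c00_val \in finsupp }.
HB.instance Definition _ := [isSub for c00_val].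
HB.instance Definition _ := [Choice of c00 by <:].
HB.instance Definition _ := [SubChoice_isSubLmodule of c00 by <:].

End Structure.

Definition c00_fun E (x : c00 E) : forall n, E n := c00_val x.
Coercion c00_fun : c00 >-> Funclass.

Section FiniteSupport.
Variable E : nat -> lmodType R.
Implicit Types x y : c00 E.

Definition supp_lt x y := forall i j : nat,
  dsupp x i -> dsupp y j -> (i < j)%N.

(* x_1 < ... < x_d, all the x_k being non-zero *)
Definition successive (xs : seq (c00 E)) : bool :=
  all (fun x => x != 0) xs && sorted (fun x y => `[< supp_lt x y >]) xs.

Fact single_subproof n (v : E n) :
  (dfwith (0 : dprod E) n v : dprod E) \in finsupp (E := E).
Proof.
apply/asboolP; apply: (sub_finite_set _ (finite_set1 n)) => k; rewrite /dsupp /=.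
have [->//|nk] := eqVneq k n.
by rewrite dfwithout 1?eq_sym// eqxx.
Qed.

(* the identification of E_n with the elements supported at n *)
Definition single n (v : E n) : c00 E := C00 (single_subproof v).

Fact tail_subproof (k : nat) x :
  ((fun n => if (n < k)%N then 0 else x n) : dprod E) \in finsupp (E := E).
Proof.
case: x => x /= /asboolP fx; apply/asboolP; apply: sub_finite_set fx => n.
by rewrite /dsupp /=; case: ifP => // _; rewrite eqxx.
Qed.

(* the restriction x|_[k, +oo) *)
Definition tail k x : c00 E := C00 (tail_subproof k x).

End FiniteSupport.
End Product.

Section HereditarilyIndecomposable.
Context {R : realType} {V : normedModType R}.
Implicit Types Y W A : set V.

Definition subspaceV Y := Y 0 /\ forall (a : R) u v, Y u -> Y v -> Y (a *: u + v).

Definition linear_span A : set V := smallest subspaceV A.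

Definition finite_dimensional Y := exists s : seq V, Y = linear_span [set` s].

(* For a closed subspace W of a Banach space V: W is an H.I. Banach space.
   The closed subspaces of W are those of V that are contained in W. *)
Definition hereditarily_indecomposable W :=
  forall Y1 Y2 : set V,
    subspaceV Y1 -> closed Y1 -> Y1 `<=` W -> ~ finite_dimensional Y1 ->
    subspaceV Y2 -> closed Y2 -> Y2 `<=` W -> ~ finite_dimensional Y2 ->
  forall eps : R, 0 < eps ->
    exists y1 y2, [/\ Y1 y1, Y2 y2 & `|y1 - y2| < eps * `|y1 + y2|].

End HereditarilyIndecomposable.

Definition separable (T : topologicalType) :=
  exists S : set T, countable S /\ dense S.

Definition dual_ball {R : realType} (V : normedModType R) : set (V -> R^o) :=
  [set f | linear f /\ forall x, `|f x| <= `|x|].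
Arguments dual_ball {R} V.

(* With suprema in \bar R the norming set is non-empty, also when V = 0. *)
Definition norming_set {R : realType} (V : normedModType R)
    (F : set (V -> R^o)) :=
  [/\ countable F,
      forall f, F f -> F (- f),
      F `<=` dual_ball V
    & forall x, (`|x|)%:E = ereal_sup [set (f x)%:E | f in F] ].

Definition parameters (m n : nat -> nat) :=
  [/\ m 1%N = 2%N,
      forall i, (1 <= i)%N -> (m i ^ 5 <= m i.+1)%N,
      n 1%N = 3%N
    & forall i, (1 <= i)%N ->
        exists s : nat, n i.+1 = (n i ^ s)%N /\ (m i.+1 ^ 3 < 2 ^ s)%N ].

Section DProduct.
Context {R : realType}.
Variable X : nat -> completeNormedModType R.

Definition Omega00 := c00 (fun n => X n : lmodType R).

(* Finitely supported families (f_n)_n of maps X_n -> R; the f_n are continuous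
   and linear for the elements of Kset and Lset, since F_n is contained in the unit
   ball of the dual of X_n. *)
Definition functional := c00 (fun n => (X n -> R^o) : lmodType R).


Definition eval00 (f : functional) (x : Omega00) : R :=
  \sum_(k \in [set: nat]) f k (x k).

Variables m n : nat -> nat.
Variable F : forall k, set (X k -> R^o).
Implicit Types (f g : functional) (fs : seq functional).

Definition F_all : set functional :=
  \bigcup_k [set single (E := fun k => (X k -> R^o) : lmodType R) phi
            | phi in @F k].

(* the functionals 1/m_i (f_1 + ... + f_d) for (f_1, ..., f_d) in P with
   1 <= d <= n_i and f_1 < ... < f_d *)
Definition averages (i : nat) (P : set (seq functional)) : set functional :=
  [set (m i)%:R^-1 *: \sum_(f <- fs) f
  | fs in [set fs | [/\ (0 < size fs <= n i)%N, successive fs & P fs]]].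

Definition all_in (S : set functional) : set (seq functional) :=
  [set fs | forall f, f \in fs -> S f].

Definition average_closed (S : set functional) :=
  forall i, (1 <= i)%N -> averages i (all_in S) `<=` S.

Definition Kset : set functional := smallest average_closed F_all.

Definition Astar (i : nat) : set functional :=
  if i == 0%N then F_all else averages i (all_in Kset).

(* j(f) = max {i : f \in A_i^*} *)
Definition jmax f : nat :=
  xget 0%N [set i | Astar i f /\ forall k, Astar k f -> (k <= i)%N].

Definition Kseq : set (seq functional) :=
  [set fs | [/\ fs <> [::], successive fs & all_in Kset fs]].

(* sigma is a total function here, but is only evaluated on Kseq: the non-zero
   elements of Lset are in Kset. *)
Definition coding (sigma : seq functional -> nat) :=
  [/\ forall fs, Kseq fs -> exists j, (1 <= j)%N /\ sigma fs = (2 * j)%N,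
      forall fs gs, Kseq fs -> Kseq gs -> sigma fs = sigma gs -> fs = gs,
      forall f, Kset f -> f <> 0 -> (jmax f < sigma [:: f])%N
    & forall fs g, fs <> [::] -> Kseq (rcons fs g) ->
        (sigma fs < sigma (rcons fs g))%N ].

Variable sigma : seq functional -> nat.

Definition plus_minus (S : set functional) : set functional :=
  S `|` [set - f | f in S].

(* In the next three definitions L0 and Li stand for L^{s-1} and (L_i^{s-1})_i,
   and i for the index 2j or 2j+1. *)
Definition L_even (L0 : set functional) (Li : nat -> set functional) i :=
  plus_minus (Li i) `|` averages i (all_in L0).

Definition special (Li : nat -> set functional) i : set (seq functional) :=
  [set fs | (exists k, (n i < k)%N /\ Li (2 * k)%N (nth 0 fs 0)) /\
            forall l, (0 < l < size fs)%N ->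
              Li (sigma (take l fs)) (nth 0 fs l)].

Definition L_odd (L0 : set functional) (Li : nat -> set functional) i :=
  \bigcup_k [set tail k f
            | f in plus_minus (Li i) `|`
                   averages i (all_in L0 `&` special Li i)].

(* the pair (L^s, i |-> L_i^s) *)
Fixpoint L_stage (s : nat) : set functional * (nat -> set functional) :=
  if s is s'.+1 then
    let: (L0, Li) := L_stage s' in
    let Li' i := if i == 0%N then set0
                 else if odd i then L_odd L0 Li i else L_even L0 Li i in
    (L0 `|` \bigcup_i Li' i, Li')
  else (F_all, fun=> set0).

Definition Lset : set functional := \bigcup_s (L_stage s).1.

Definition normL (x : Omega00) : \bar R :=
  ereal_sup [set (eval00 f x)%:E | f in Lset].

(* The Banach space Z, with the canonical map iota, is the completion of
   Omega00 for the norm normL. *)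
Definition is_d_product (Z : completeNormedModType R)
    (iota : {linear Omega00 -> Z}) :=
  (forall x, (`|iota x|)%:E = normL x) /\ dense (range iota).

End DProduct.

Section Blocks.
Context {R : realType} {X : nat -> completeNormedModType R}.
Context {Z : completeNormedModType R}.
Variable iota : {linear Omega00 X -> Z}.

Definition block_sequence (x : nat -> Omega00 X) :=
  forall k, x k <> 0 /\ supp_lt (x k) (x k.+1).

Definition block_subspace (x : nat -> Omega00 X) : set Z :=
  closure (linear_span (range (iota \o x))).

Definition block_HI := forall x, block_sequence x ->
  hereditarily_indecomposable (block_subspace x).

End Blocks.

(* Main.v *)
Require Import Defs.
From mathcomp Require Import all_boot all_order all_algebra.
From mathcomp Require Import all_classical all_reals all_analysis.
From mathcomp Require Import zify lra.

(** Given infinite dimensional subspaces Y1 and Y2 of a block subspace, one looks for a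
    finite sequence of vectors, taken alternately near Y1 and near Y2, whose sum is
    large and whose alternating sum is small.

    A gliding hump argument ([gliding_hump], [rich_approximation]) replaces Y1 and Y2
    by spaces of finitely supported vectors which contain vectors arbitrarily far
    out ([rich]). In such a space the following vectors are built one from another.

    Averages of n_j vectors, j odd, on which sums of up to n_{j-1} successive
    elements of L are uniformly bounded ([flat], [l1_average]). If there were none,
    iterating averages of n_j terms would make the average of n_{j+1} normalized
    vectors smaller than 1/(2 m_{j+1}), but the averages of even weight j + 1 in L, which
    may be formed freely, show that it is not.

    Exact pairs (z, f) of even index j ([exists_exact_pair]): f in L has weight j,
    f(z) = 1, and every functional of another weight is small on z. Up to a factor, z
    is an average of n_j flat vectors with rapidly increasing indices. Its
    estimates, and the final one below, come from the elementary inequality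
    [iterated_cut]: a functional of weight i < j is cut into n_i pieces, at the cost of a
    factor 1/m_i <= 1/2, and the pieces are cut again, until they have weight at
    least j or the accumulated factor is small. As n_j = n_{j-1}^s with 2^s > m_j^3,
    the number of pieces is still negligible against n_j.

    Dependent sequences of exact pairs (z_k, f_k) ([exists_dependent]): the index of each
    pair is the code of the functionals before it. For odd j the functional
    (f_1 + ... + f_d) / m_j, d = n_j, is then in L, so that the sum of z_1, ..., z_d has
    norm at least n_j / m_j. Let g in L be another functional of weight j, built on
    g_1 < ... < g_e. Since the coding is injective, the g_r agree with the f_r up to
    some r, and afterwards their weights differ from the indices of the z_k, so
    that g is small there. On the common part g takes the same value at each z_k,
    and these values cancel in the alternating sum ([special_values],
    [special_sum]). Functionals of weight j, the only ones that can be large on the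
    sum of the z_k, are therefore harmless for the alternating sum, and
    [iterated_cut] shows that its norm is at most a small multiple of n_j / m_j
    ([dependent_alternating], [rich_HI]). *)

Set Implicit Arguments.
Unset Strict Implicit.
Unset Printing Implicit Defensive.

Import Order.TTheory GRing.Theory Num.Theory.
Import numFieldNormedType.Exports.

Local Open Scope classical_set_scope.
Local Open Scope ring_scope.

(** * Finitely supported families *)

Section FiniteSupportTheory.
Context {R : realType} {E : nat -> lmodType R}.
Implicit Types (x y : c00 E) (xs : seq (c00 E)).

Lemma c00P x y : (forall k, x k = y k) -> x = y.
Proof. by move=> xy; apply: val_inj; apply: functional_extensionality_dep. Qed.

Lemma c00D x y k : (x + y) k = x k + y k. Proof. by []. Qed.
Lemma c00N x k : (- x) k = - x k. Proof. by []. Qed.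
Lemma c00Z (a : R) x k : (a *: x) k = a *: x k. Proof. by []. Qed.
Lemma c000 k : (0 : c00 E) k = 0. Proof. by []. Qed.

Lemma c00_sum (I : Type) (r : seq I) (P : pred I) (f : I -> c00 E) k :
  (\sum_(i <- r | P i) f i) k = \sum_(i <- r | P i) f i k.
Proof. by elim/big_rec2: _ => // i a b Pi <-. Qed.

Lemma supp_bound x : exists B, forall k, (B <= k)%N -> x k = 0.
Proof.
case: x => x fx; move/asboolP: (fx) => /finite_seqP[s sE].
exists (\max_(i <- s) i).+1 => k sk; apply/eqP; apply: contraT => xk.
have ks : k \in s by have : dsupp x k by []; rewrite sE.
by move: sk; rewrite ltnNge leq_bigmax_seq.
Qed.

Definition supp_in (p q : nat) x := forall k, (k < p)%N || (q <= k)%N -> x k = 0.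

Lemma supp_in_sub p q p' q' x : (p' <= p)%N -> (q <= q')%N ->
  supp_in p q x -> supp_in p' q' x.
Proof. by move=> pp qq w k kk; apply: w; lia. Qed.

Lemma supp_inD p q x y : supp_in p q x -> supp_in p q y -> supp_in p q (x + y).
Proof. by move=> wx wy k kk; rewrite c00D wx// wy// addr0. Qed.

Lemma supp_inZ p q a x : supp_in p q x -> supp_in p q (a *: x).
Proof. by move=> wx k kk; rewrite c00Z wx// scaler0. Qed.

Lemma supp_in_sum (I : eqType) (r : seq I) (f : I -> c00 E) p q :
  (forall i, i \in r -> supp_in p q (f i)) -> supp_in p q (\sum_(i <- r) f i).
Proof.
move=> wf; rewrite big_seq_cond; elim/big_ind: _ => //.
  by move=> ? ?; exact: supp_inD.
by move=> i /andP[/wf].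
Qed.

Lemma exists_supp_in p x : (forall k, (k < p)%N -> x k = 0) ->
  exists2 q, (p < q)%N & supp_in p q x.
Proof.
move=> px; have [B xB] := supp_bound x; exists (maxn B p.+1); first lia.
by move=> k /orP[/px//|kB]; apply: xB; lia.
Qed.

Lemma tailE p x k : tail p x k = if (k < p)%N then 0 else x k.
Proof. by []. Qed.

Lemma tailD p x y : tail p (x + y) = tail p x + tail p y.
Proof. by apply: c00P => k; rewrite c00D !tailE c00D; case: ifP; rewrite ?addr0. Qed.

Lemma tailZ p a x : tail p (a *: x) = a *: tail p x.
Proof. by apply: c00P => k; rewrite c00Z !tailE c00Z; case: ifP; rewrite ?scaler0. Qed.

Lemma tailN p x : tail p (- x) = - tail p x.
Proof. by rewrite -scaleN1r tailZ scaleN1r. Qed.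

Lemma tail_0 p : tail p (0 : c00 E) = 0.
Proof. by apply: c00P => k; rewrite tailE; case: ifP. Qed.

Lemma tail_sum (I : Type) (r : seq I) (f : I -> c00 E) p :
  tail p (\sum_(i <- r) f i) = \sum_(i <- r) tail p (f i).
Proof. by elim/big_rec2: _ => [|i a b _ <-]; rewrite ?tail_0 ?tailD. Qed.

Lemma tail_id p x : (forall k, (k < p)%N -> x k = 0) -> tail p x = x.
Proof. by move=> px; apply: c00P => k; rewrite tailE; case: ifP => // /px. Qed.

Lemma tail0n x : tail 0 x = x. Proof. exact: tail_id. Qed.

Lemma supp_in_tail p q r x : supp_in p q x -> supp_in p q (tail r x).
Proof. by move=> w k kk; rewrite tailE w//; case: ifP. Qed.

Lemma tailE0 p q r x : supp_in p q x -> (q <= r)%N -> tail r x = 0.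
Proof.
by move=> w qr; apply: c00P => k; rewrite tailE; case: ifP => // kr; apply: w; lia.
Qed.

Lemma supp_ltP x y :
  supp_lt x y <-> forall i j, x i <> 0 -> y j <> 0 -> (i < j)%N.
Proof. by split=> h i j => [/eqP ? /eqP ?|/eqP ? /eqP ?]; exact: h. Qed.

(** Successive families in which zero terms are allowed: unlike [successive]
    this is stable under restriction to a tail and under taking subfamilies. *)
Definition wsuccessive xs := pairwise (fun x y => `[< supp_lt x y >]) xs.

Lemma wsuccessive_cons x xs :
  wsuccessive (x :: xs) <-> (forall y, y \in xs -> supp_lt x y) /\ wsuccessive xs.
Proof.
rewrite /wsuccessive pairwise_cons; split.
  by move=> /andP[/allP a ->]; split=> // y /a /asboolP.
by move=> [a ->]; rewrite andbT; apply/allP => y /a yx; apply/asboolP.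
Qed.

Lemma wsuccessive_lt xs i j : wsuccessive xs -> (i < j < size xs)%N ->
  supp_lt (nth 0 xs i) (nth 0 xs j).
Proof.
move=> /(pairwiseP 0) s /andP[ij js]; apply/asboolP; apply: s; rewrite ?inE//.
by apply: ltn_trans js.
Qed.

Lemma wsuccessive_map (f : c00 E -> c00 E) xs :
  (forall x k, x k = 0 -> f x k = 0) -> wsuccessive xs -> wsuccessive (map f xs).
Proof.
move=> f0; elim: xs => // x xs IH /wsuccessive_cons[xxs /IH s] /=; apply/wsuccessive_cons; split=> //.
move=> _ /mapP[y yxs ->]; apply/supp_ltP => i j fxi fyj.
by move/supp_ltP: (xxs y yxs); apply=> /f0.
Qed.

Lemma nz_supp x : x <> 0 -> exists k, x k != 0.
Proof.
move=> x0; apply: contrapT => nx; apply: x0; apply: c00P => k; rewrite c000.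
by apply/eqP; apply: contraT => h; case: nx; exists k.
Qed.

Lemma successiveW xs : successive xs -> wsuccessive xs.
Proof.
move=> /andP[nz s]; rewrite /wsuccessive -(sorted_pairwise_in (P := [pred x | x != 0]))//.
move=> y x z /= y0 _ _ /asboolP xy /asboolP yz; apply/asboolP => i k xi zk.
have [j yj] := nz_supp (elimN eqP y0); exact: ltn_trans (xy _ _ xi yj) (yz _ _ yj zk).
Qed.

Lemma successive_nz xs x : successive xs -> x \in xs -> x <> 0.
Proof. by move=> /andP[/allP nz _] /nz /eqP. Qed.

Lemma filter_successive xs : wsuccessive xs ->
  successive [seq x <- xs | x != 0].
Proof.
move=> s; rewrite /successive filter_all /=.
by apply: pairwise_sorted; exact: pairwise_filter.
Qed.

Lemma sum_filter xs : \sum_(x <- [seq x <- xs | x != 0]) x = \sum_(x <- xs) x.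
Proof.
rewrite big_filter [RHS](bigID (fun x => x != 0)) /= [X in _ + X]big1 ?addr0//.
by move=> x /negPn/eqP.
Qed.

(** Disjointness of the supports: each coordinate of a sum of a successive
    family is a coordinate of one of its terms. *)
Lemma wsuccessive_coord xs k : wsuccessive xs ->
  (\sum_(x <- xs) x) k = 0 \/
  exists2 x, x \in xs & (\sum_(x <- xs) x) k = x k.
Proof.
elim: xs => [|x xs IH]; first by rewrite big_nil; left.
move=> /wsuccessive_cons[xxs s]; rewrite big_cons c00D.
have [xk0|xk] := eqVneq (x k) 0.
  rewrite xk0 add0r; case: (IH s) => [->|[y yxs ->]]; first by left.
  by right; exists y => //; rewrite inE yxs orbT.
right; exists x; first by rewrite inE eqxx.
rewrite c00_sum big_seq big1 ?addr0// => y yxs; apply/eqP; apply: contraT => yk.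
by have := xxs y yxs k k xk yk; rewrite ltnn.
Qed.

(** Fixing the windows beforehand makes it possible to compare a sequence of vectors
    with a sequence of functionals, or with sums of consecutive terms, without
    looking at supports; zero terms do no harm. *)
Definition blocks (a : nat -> nat) (u : nat -> c00 E) :=
  (forall k, (a k <= a k.+1)%N) /\ forall k, supp_in (a k) (a k.+1) (u k).

Lemma blocks_mono a u k l : blocks a u -> (k <= l)%N -> (a k <= a l)%N.
Proof.
by move=> [h _] kl; rewrite -(subnKC kl); elim: (_ - _)%N => [|d IH];
  rewrite ?addn0// addnS (leq_trans IH).
Qed.

Lemma blocks_sum a u i b : blocks a u -> (i <= b)%N ->
  supp_in (a i) (a b) (\sum_(i <= k < b) u k).
Proof.
move=> bu ib; apply: supp_in_sum => k; rewrite mem_index_iota => /andP[ik kb].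
case: (bu) => _ /(_ k); apply: supp_in_sub; exact: blocks_mono bu _.
Qed.

Lemma blocks_support a u k c : blocks a u -> u k c <> 0 -> (a k <= c < a k.+1)%N.
Proof.
case=> _ w uc; apply/andP; split.
  by rewrite leqNgt; apply/negP => h; apply: uc; apply: (w k); rewrite h.
by rewrite ltnNge; apply/negP => h; apply: uc; apply: (w k); rewrite h orbT.
Qed.

Lemma blocks_lt a u k l : blocks a u -> (k < l)%N -> supp_lt (u k) (u l).
Proof.
move=> bu kl; apply/supp_ltP => i j /(blocks_support bu)/andP[_ ik] /(blocks_support bu)/andP[lj _].
exact: leq_trans ik (leq_trans (blocks_mono bu kl) lj).
Qed.

Lemma blocks_successive a u N : blocks a u -> (forall k, (k < N)%N -> u k <> 0) ->
  successive (mkseq u N).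
Proof.
move=> bu u0; apply/andP; split.
  by apply/allP => _ /mapP[k + ->]; rewrite mem_iota => /u0/eqP.
apply: (pairwise_sorted (e := fun x y => `[< supp_lt x y >])); apply/(pairwiseP 0) => i j.
rewrite !inE size_mkseq => iN jN ij; rewrite !nth_mkseq//.
exact: (blocks_lt bu ij).
Qed.

End FiniteSupportTheory.

Lemma blocks_index (R : realType) (E E' : nat -> lmodType R) a
    (u : nat -> c00 E) (w : nat -> c00 E') k l c :
  blocks a u -> blocks a w -> u k c <> 0 -> w l c <> 0 -> k = l.
Proof.
move=> bu bw /(blocks_support bu)/andP[k1 k2] /(blocks_support bw)/andP[l1 l2].
have [kl|lk|//] := ltngtP k l.
  by have := leq_trans k2 (leq_trans (blocks_mono bu kl) l1); rewrite ltnn.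
by have := leq_trans l2 (leq_trans (blocks_mono bu lk) k1); rewrite ltnn.
Qed.

(** All the sequences below are built in this way: the next object is chosen knowing
    its predecessors and a place p beyond them, and it determines the place q
    beyond which its successor has to start. *)
Lemma block_choice (T : Type) (P : seq T -> nat -> T -> nat -> Prop) p0 :
  (forall hist p, exists o q, P hist p o q) ->
  exists (o : nat -> T) (a : nat -> nat),
    a 0%N = p0 /\ forall k, P (mkseq o k) (a k) (o k) (a k.+1).
Proof.
move=> h.
have [hp|f hf] := @choice _ _ (fun hp oq : (_ * nat)%type => P hp.1 hp.2 oq.1 oq.2).
  by have [ob [q Po]] := h hp.1 hp.2; exists (ob, q).
pose st k := iter k (fun hp => (rcons hp.1 (f hp).1, (f hp).2)) ([::], p0).
exists (fun k => (f (st k)).1), (fun k => (st k).2); split=> // k.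
suff -> : mkseq (fun k => (f (st k)).1) k = (st k).1 by exact: hf.
by elim: k => // k IH; rewrite mkseqS IH.
Qed.

(** * The norming set L: structure, stability, weights *)

Section Evaluation.
Context {R : realType} {X : nat -> completeNormedModType R}.
Implicit Types (f g : functional X) (fs : seq (functional X)) (x y : Omega00 X).

Definition dual_ball00 f := forall k, dual_ball (X k) (f k).

Lemma dual_ball00_lin f k a u v : dual_ball00 f -> f k (a *: u + v) = a * f k u + f k v.
Proof. by move=> /(_ k)[l _]; exact: l. Qed.

Lemma dual_ball00_at0 f k : dual_ball00 f -> f k 0 = 0.
Proof. by move=> bf; have := @dual_ball00_lin f k 1 0 0 bf; rewrite scaler0 addr0; lra. Qed.

Lemma dual_ball00_0 : dual_ball00 0.
Proof.
move=> k; split=> [a u v|v]; rewrite !c000 /=; first by rewrite scaler0 addr0.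
by rewrite normr0.
Qed.

Lemma eval00E B f x : (forall k, (B <= k)%N -> f k = 0) ->
  eval00 f x = \sum_(k < B) f k (x k).
Proof.
move=> fB; rewrite /eval00 (fsbig_ord _ _ (fun k => f k (x k))).
apply/esym/fsbig_widen => // k /= [_ /negP kB].
by rewrite fB// leqNgt.
Qed.

Lemma evalDl f g x : eval00 (f + g) x = eval00 f x + eval00 g x.
Proof.
have [B1 f0] := supp_bound f; have [B2 g0] := supp_bound g.
have fB k : (maxn B1 B2 <= k)%N -> f k = 0 by move=> h; apply: f0; lia.
have gB k : (maxn B1 B2 <= k)%N -> g k = 0 by move=> h; apply: g0; lia.
rewrite (eval00E _ fB) (eval00E _ gB) (@eval00E (maxn B1 B2)) ?big_split// => k h.
by rewrite c00D fB// gB// addr0.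
Qed.

Lemma evalZl a f x : eval00 (a *: f) x = a * eval00 f x.
Proof.
have [B f0] := supp_bound f; rewrite (eval00E _ f0) (@eval00E B) ?mulr_sumr// => k h.
by rewrite c00Z f0// scaler0.
Qed.

Lemma eval0l x : eval00 (0 : functional X) x = 0.
Proof. by rewrite -(scale0r (0 : functional X)) evalZl mul0r. Qed.

Lemma evalNl f x : eval00 (- f) x = - eval00 f x.
Proof. by rewrite -scaleN1r evalZl mulN1r. Qed.

Lemma eval_suml fs x : eval00 (\sum_(f <- fs) f) x = \sum_(f <- fs) eval00 f x.
Proof. by elim/big_rec2: _ => [|f a b _ <-]; rewrite ?eval0l ?evalDl. Qed.

Lemma evalPr f a x y : dual_ball00 f -> eval00 f (a *: x + y) = a * eval00 f x + eval00 f y.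
Proof.
move=> bf; have [B f0] := supp_bound f; rewrite !(eval00E _ f0) mulr_sumr -big_split.
by apply: eq_bigr => k _; exact: dual_ball00_lin.
Qed.

Lemma eval0r f : dual_ball00 f -> eval00 f 0 = 0.
Proof. by move=> bf; have := evalPr 1 0 0 bf; rewrite scaler0 addr0; lra. Qed.

Lemma evalDr f x y : dual_ball00 f -> eval00 f (x + y) = eval00 f x + eval00 f y.
Proof. by move=> bf; rewrite -(scale1r x) evalPr// scale1r mul1r. Qed.

Lemma evalZr f a x : dual_ball00 f -> eval00 f (a *: x) = a * eval00 f x.
Proof. by move=> bf; rewrite -(addr0 (a *: x)) evalPr// eval0r// addr0. Qed.

Lemma evalNr f x : dual_ball00 f -> eval00 f (- x) = - eval00 f x.
Proof. by move=> bf; rewrite -scaleN1r evalZr// mulN1r. Qed.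

Lemma eval_sumr (I : Type) (r : seq I) f (x : I -> Omega00 X) : dual_ball00 f ->
  eval00 f (\sum_(i <- r) x i) = \sum_(i <- r) eval00 f (x i).
Proof.
by move=> bf; elim/big_rec2: _ => [|i a b _ <-]; rewrite ?eval0r// evalDr.
Qed.

(** Functionals are moved to the right by cutting their tails, and this is the same
    as cutting the vector: hence tails do not increase the norm. *)
Lemma eval_tail p f x : dual_ball00 f -> eval00 (tail p f) x = eval00 f (tail p x).
Proof.
move=> bf; have [B f0] := supp_bound f; rewrite (eval00E _ f0) (@eval00E B).
  by apply: eq_bigr => k _; rewrite !tailE; case: ifP => // _; rewrite dual_ball00_at0.
by move=> k h; rewrite tailE f0//; case: ifP.
Qed.

Lemma eval_disj f x : dual_ball00 f -> (forall k, f k = 0 \/ x k = 0) -> eval00 f x = 0.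
Proof.
move=> bf fx; have [B f0] := supp_bound f; rewrite (eval00E _ f0) big1// => k _.
by case: (fx k) => -> //; rewrite dual_ball00_at0.
Qed.

Lemma eval_before f x p q : dual_ball00 f -> supp_in p q x ->
  (forall k : nat, (k < q)%N -> f k = 0) ->
  eval00 f x = 0.
Proof.
move=> bf wx wf; apply: eval_disj => // k.
by have [kq|kq] := ltnP k q; [left; exact: wf|right; apply: wx; lia].
Qed.

Lemma dual_ball00_tail p f : dual_ball00 f -> dual_ball00 (tail p f).
Proof. by move=> bf k; rewrite tailE; case: ifP => // _; exact: dual_ball00_0. Qed.

Lemma dual_ball00_avg (c : R) fs : 0 <= c <= 1 -> wsuccessive fs ->
  (forall f, f \in fs -> dual_ball00 f) -> dual_ball00 (c *: \sum_(f <- fs) f).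
Proof.
move=> /andP[c0 c1] s bfs k; rewrite c00Z; case: (wsuccessive_coord k s) => [->|[f ffs ->]].
  by rewrite scaler0; exact: dual_ball00_0.
have bf := bfs f ffs; have [_ b] := bf k; split=> [a u v|v].
  change (c * f k (a *: u + v) = a * (c * f k u) + c * f k v).
  by rewrite dual_ball00_lin//; lra.
change (`|c * f k v| <= `|v|); rewrite normrM ger0_norm//.
by rewrite (le_trans _ (b v))// ler_piMl.
Qed.

End Evaluation.

Section Growth.
Variables (m n : nat -> nat).
Hypothesis hmn : parameters m n.

Lemma m_exp i : (1 <= i)%N -> (2 ^ i <= m i)%N.
Proof.
case: hmn => m1 mS _ _; elim: i => // -[|i] IH _; first by rewrite m1.
apply: leq_trans (mS i.+1 isT); rewrite expnS.
have h := IH isT; have h2 : (2 <= m i.+1)%N.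
  by apply: leq_trans h; rewrite expnS; have := expn_gt0 2 i; lia.
apply: (@leq_trans (m i.+1 * m i.+1)%N); first exact: leq_mul.
by rewrite mulnn leq_exp2l.
Qed.

Lemma m_ge2 i : (1 <= i)%N -> (2 <= m i)%N.
Proof. by case: i => // i _; apply: leq_trans (m_exp _) => //; rewrite expnS; have := expn_gt0 2 i; lia. Qed.

Lemma mS5 i : (1 <= i)%N -> (m i ^ 5 <= m i.+1)%N.
Proof. by case: hmn => _ h _ _; exact: h. Qed.

Lemma m_mono i j : (1 <= i <= j)%N -> (m i <= m j)%N.
Proof.
move=> /andP[i1 ij]; rewrite -(subnKC ij); elim: (_ - _)%N => [|d IH]; first by rewrite addn0.
rewrite addnS (leq_trans IH)// (leq_trans _ (mS5 _)) ?(leq_trans i1) ?leq_addr//.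
by rewrite -[X in (X <= _)%N]expn1 leq_exp2l// m_ge2// (leq_trans i1) ?leq_addr.
Qed.

Lemma n_step i : (1 <= i)%N ->
  exists s, n i.+1 = (n i ^ s)%N /\ (m i.+1 ^ 3 < 2 ^ s)%N.
Proof. by case: hmn => _ _ _; exact. Qed.

Lemma n_ge3 i : (1 <= i)%N -> (3 <= n i)%N.
Proof.
case: hmn => _ _ n1 _; elim: i => // -[|i] IH _; first by rewrite n1.
have [s [-> hs]] := n_step (i := i.+1) isT; have := IH isT => h.
case: s hs => [|s _]; last by rewrite expnS (leq_trans h)// leq_pmulr// expn_gt0; lia.
by rewrite expn0 ltnS leqn0 expn_eq0; have := m_ge2 (i := i.+2) isT; lia.
Qed.

Lemma n_mono i j : (1 <= i <= j)%N -> (n i <= n j)%N.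
Proof.
move=> /andP[i1 ij]; rewrite -(subnKC ij); elim: (_ - _)%N => [|d IH]; first by rewrite addn0.
rewrite addnS (leq_trans IH)//; have id1 : (1 <= i + d)%N by lia.
have [s [-> hs]] := n_step id1; case: s hs => [|s _].
  by rewrite expn0 ltnS leqn0 expn_eq0; have := @m_ge2 (i + d).+1 isT; lia.
by rewrite expnS leq_pmulr// expn_gt0; have := n_ge3 id1; lia.
Qed.

End Growth.

Section NormingSet.
Context {R : realType} {X : nat -> completeNormedModType R}.
Variables (m n : nat -> nat) (F : forall k, set (X k -> R^o)).
Variable sigma : seq (functional X) -> nat.
Hypotheses (hmn : parameters m n) (hF : forall k, norming_set (@F k)).
Hypothesis hsigma : coding m n F sigma.
Implicit Types (f g : functional X) (fs gs : seq (functional X)).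

Notation K := (Kset m n F).
Notation L := (Lset m n F sigma).
Notation stage s := (L_stage m n F sigma s).

Definition withzero (S : set (functional X)) := S `|` [set 0].

(** Zero terms are allowed because cutting a sum may annihilate some of its terms:
    these averages, unlike [averages i (all_in S)], are closed under tails. *)
Definition waverages i (S : set (functional X)) : set (functional X) :=
  [set f | exists gs, [/\ (size gs <= n i)%N, wsuccessive gs,
     forall g, g \in gs -> withzero S g & f = (m i)%:R^-1 *: \sum_(g <- gs) g]].

Lemma averagesW i S f : averages m n i (all_in S) f -> waverages i S f.
Proof.
case=> fs [/andP[_ sz] /successiveW s Sfs] <-; exists fs; split=> //.
by move=> g /Sfs; left.
Qed.

Lemma waverages_nz i S f : waverages i S f -> f <> 0 -> averages m n i (all_in S) f.
Proof.
case=> gs [sz s Sgs ->] nz; exists [seq g <- gs | g != 0]; last by rewrite sum_filter.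
split; last 2 first.
- exact: filter_successive.
- by move=> g; rewrite mem_filter => /andP[/eqP g0 /Sgs[]].
apply/andP; split; last by rewrite size_filter (leq_trans (count_size _ _)).
rewrite lt0n; apply/negP => /nilP h; apply: nz.
by rewrite -sum_filter h big_nil scaler0.
Qed.

Lemma waverages_opp i S T f : (forall g, S g -> T (- g)) -> waverages i S f -> waverages i T (- f).
Proof.
move=> SN [gs [sz s Sgs ->]]; exists (map -%R gs); split.
- by rewrite size_map.
- by apply: wsuccessive_map s => x k; rewrite c00N => ->; rewrite oppr0.
- by move=> _ /mapP[g /Sgs[/SN Sg|->] ->]; [left|right; rewrite oppr0].
- by rewrite big_map sumrN scalerN.
Qed.

Lemma waverages_tail p i S T f : (forall g, S g -> withzero T (tail p g)) ->
  waverages i S f -> waverages i T (tail p f).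
Proof.
move=> ST [gs [sz s Sgs ->]]; exists (map (tail p) gs); split.
- by rewrite size_map.
- by apply: wsuccessive_map s => x k; rewrite tailE => ->; case: ifP.
- by move=> _ /mapP[g /Sgs[/ST h|->] ->]; [exact: h|right; rewrite tail_0].
- by rewrite big_map tailZ tail_sum.
Qed.

Lemma waverages_sub i S T f : S `<=` withzero T -> waverages i S f -> waverages i T f.
Proof.
move=> ST [gs [sz s Sgs ->]]; exists gs; split=> // g /Sgs[/ST//|->]; by right.
Qed.

Lemma single_coord k (v : X k -> R^o) j :
  j <> k -> single (E := fun k => (X k -> R^o) : lmodType R) v j = 0.
Proof. by move=> jk; apply: dfwithout; apply/eqP => kj; apply: jk. Qed.

Lemma single_in k (v : X k -> R^o) :
  single (E := fun k => (X k -> R^o) : lmodType R) v k = v.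
Proof. exact: dfwithin. Qed.

Lemma singleN k (v : X k -> R^o) :
  single (E := fun k => (X k -> R^o) : lmodType R) (- v) =
  - single (E := fun k => (X k -> R^o) : lmodType R) v.
Proof.
apply: c00P => j; rewrite c00N; have [jk|jk] := eqVneq j k; last first.
  by rewrite !single_coord ?oppr0//; exact/eqP.
by subst j; rewrite !single_in.
Qed.

Lemma F_all_opp f : F_all F f -> F_all F (- f).
Proof.
case=> k _ [v Fv <-]; exists k => //; exists (- v); last exact: singleN.
by case: (hF k) => _ h _ _; exact: h.
Qed.

Lemma F_all_tail p f : F_all F f -> tail p f = f \/ tail p f = 0.
Proof.
case=> k _ [v Fv <-]; have [kp|pk] := ltnP k p; [right|left].
  apply: c00P => j; rewrite tailE; case: ltnP => // pj.
  by apply: single_coord; lia.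
by apply: tail_id => j jp; apply: single_coord; lia.
Qed.

Lemma F_all_ball f : F_all F f -> dual_ball00 f.
Proof.
case=> k _ [v Fv <-] j; have [jk|jk] := eqVneq j k.
  by subst j; rewrite single_in; case: (hF k) => _ _ h _; exact: h.
by rewrite single_coord; [exact: dual_ball00_0|exact/eqP].
Qed.

Lemma K_F_all : F_all F `<=` K. Proof. exact: sub_gen_smallest. Qed.

Lemma K_avg : average_closed m n K.
Proof.
move=> i i1 f [fs [sz s Kfs] <-] M [Mc FM]; apply: (Mc i i1); exists fs => //; split=> //.
by move=> g /Kfs; apply.
Qed.

Lemma K_waverages i f : (1 <= i)%N -> waverages i K f -> f <> 0 -> K f.
Proof. by move=> i1 a f0; apply: (K_avg i1); exact: waverages_nz. Qed.

Lemma K_ball f : K f -> dual_ball00 f.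
Proof.
move: f; apply: smallest_sub => [i i1 f [fs [_ s bfs] <-]|]; last exact: F_all_ball.
apply: dual_ball00_avg => //; last exact: successiveW.
have m1 : 1 <= (m i)%:R :> R by rewrite ler1n (leq_trans _ (m_ge2 hmn i1)).
by rewrite invr_ge0 ler0n invf_le1 ?(lt_le_trans ltr01).
Qed.

Lemma K_opp_tail f : K f -> [/\ K f, K (- f) & forall p, withzero K (tail p f)].
Proof.
suff : K `<=` [set f | [/\ K f, K (- f) & forall p, withzero K (tail p f)]] by apply.
apply: smallest_sub => [i i1 {}f|{}f Ff]; last first.
  split; [exact: K_F_all|exact: (K_F_all (F_all_opp Ff))|move=> p].
  by case: (F_all_tail p Ff) => ->; [left; exact: K_F_all|right].
move=> af; have a := averagesW af.
have Kf : K f by apply: (K_avg i1); case: af => gs [sz s Sgs] <-; exists gs => //; split=> // g /Sgs; case.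
have KN : waverages i K (- f) by apply: waverages_opp a => g; case.
have KT p : waverages i K (tail p f) by apply: waverages_tail a => g; case=> _ _; exact.
split=> // [|p].
  have [f0|/eqP f0] := eqVneq f 0; first by rewrite f0 oppr0 -f0.
  by apply: (K_waverages i1 KN) => /(congr1 -%R); rewrite opprK oppr0.
have [f0|/eqP f0] := eqVneq (tail p f) 0; first by right.
by left; exact: (K_waverages i1 (KT p)).
Qed.

(** ** The stages of the construction of L *)

Lemma stage2E s i : (stage s.+1).2 i =
  if i == 0%N then set0
  else if odd i then L_odd m n sigma (stage s).1 (stage s).2 i
       else L_even m n (stage s).1 (stage s).2 i.
Proof. by rewrite /=; case: (stage s). Qed.

Lemma stage1E s : (stage s.+1).1 = (stage s).1 `|` \bigcup_i (stage s.+1).2 i.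
Proof. by rewrite /=; case: (stage s). Qed.

Lemma stage1S s f : (stage s).1 f -> (stage s.+1).1 f.
Proof. by rewrite stage1E; left. Qed.

Lemma stage2_pos s i f : (stage s).2 i f -> (1 <= i)%N.
Proof. by case: s => // s; rewrite stage2E; case: i. Qed.

Lemma stage2_pm s i f : plus_minus ((stage s).2 i) f -> (stage s.+1).2 i f.
Proof.
move=> h; have i1 : (1 <= i)%N by case: h => [/stage2_pos//|[g /stage2_pos]].
rewrite stage2E; case: eqP => [i0|_]; first by rewrite i0 in i1.
case: ifP => _; last by left.
by exists 0%N => //; exists f; rewrite ?tail0n//; left.
Qed.

Lemma stage2S s i f : (stage s).2 i f -> (stage s.+1).2 i f.
Proof. by move=> h; apply: stage2_pm; left. Qed.

Lemma stage1_mono s t f : (s <= t)%N -> (stage s).1 f -> (stage t).1 f.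
Proof.
by move=> st h; rewrite -(subnKC st); elim: (_ - _)%N => [|d]; rewrite ?addn0// addnS => /stage1S.
Qed.

Lemma stage2_mono s t i f : (s <= t)%N -> (stage s).2 i f -> (stage t).2 i f.
Proof.
by move=> st h; rewrite -(subnKC st); elim: (_ - _)%N => [|d]; rewrite ?addn0// addnS => /stage2S.
Qed.

Lemma stage21 s i f : (stage s).2 i f -> (stage s).1 f.
Proof. by case: s => // s h; rewrite stage1E; right; exists i. Qed.

Definition Lweight i : set (functional X) := \bigcup_s (stage s).2 i.

Lemma Lweight_L i f : Lweight i f -> L f.
Proof. by case=> s _ /stage21 h; exists s. Qed.

Lemma L_F_all f : F_all F f -> L f. Proof. by exists 0%N. Qed.

Lemma stage_cases s f : (stage s).1 f -> F_all F f \/ exists i, [/\ (1 <= i)%N & Lweight i f].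
Proof.
elim: s => [|s IH]; first by left.
rewrite stage1E => -[/IH//|[i _ h]]; right; exists i; split; first exact: stage2_pos h.
by exists s.+1.
Qed.

Lemma L_cases f : L f -> F_all F f \/ exists i, [/\ (1 <= i)%N & Lweight i f].
Proof. by case=> s _; exact: stage_cases. Qed.

Lemma Lweight_opp i f : Lweight i f -> Lweight i (- f).
Proof. by case=> s _ h; exists s.+1 => //; apply: stage2_pm; right; exists f. Qed.

Lemma L_opp f : L f -> L (- f).
Proof.
by move=> /L_cases[/F_all_opp/L_F_all//|[i [_ /Lweight_opp/Lweight_L]]].
Qed.

Lemma common_stage (N : nat) (P : nat -> nat -> Prop) :
  (forall l s t, (s <= t)%N -> P l s -> P l t) ->
  (forall l, (l < N)%N -> exists s, P l s) -> exists s, forall l, (l < N)%N -> P l s.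
Proof.
move=> Pm; elim: N => [|N IH] h; first by exists 0%N.
have [l lN|s hs] := IH; first by apply: h; lia.
have [t ht] := h N (ltnSn _); exists (maxn s t) => l.
rewrite ltnS leq_eqVlt => /orP[/eqP->|/hs hl]; [apply: Pm ht; lia|apply: Pm hl; lia].
Qed.

Lemma common_stageL fs : (forall f, f \in fs -> L f) ->
  exists s, forall f, f \in fs -> (stage s).1 f.
Proof.
move=> Lfs; have [||s hs] := @common_stage (size fs) (fun l s => (stage s).1 (nth 0 fs l)).
- by move=> l s t; exact: stage1_mono.
- by move=> l lfs; have [s _ h] := Lfs _ (mem_nth 0 lfs); exists s.
- by exists s => f ffs; have := hs (index f fs); rewrite index_mem nth_index//; exact.
Qed.

Lemma L_even_avg i : (1 <= i)%N -> ~~ odd i -> averages m n i (all_in L) `<=` Lweight i.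
Proof.
move=> i1 ei f [fs [sz s /common_stageL[t ht]] <-]; exists t.+1 => //.
by rewrite stage2E (negbTE ei); case: eqP => [i0|_]; [by rewrite i0 in i1|right; exists fs].
Qed.

Lemma L_odd_avg i : odd i -> averages m n i (all_in L `&` special n sigma Lweight i) `<=` Lweight i.
Proof.
move=> oi f [fs [sz s [/common_stageL[t ht] [[k [nk [t1 _ h1]]] h]]] <-].
have [||t2 h2] := @common_stage (size fs)
  (fun l s => (0 < l)%N -> (stage s).2 (sigma (take l fs)) (nth 0 fs l)).
- by move=> l a b ab h3 l0; apply: (stage2_mono ab); exact: h3.
- move=> l ls; case: l ls => [|l] ls; first by exists 0%N.
  by have [|a _ ?] := h l.+1; [rewrite ls|exists a].
exists (maxn t (maxn t1 t2)).+1 => //; rewrite stage2E oi.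
case: eqP => [i0|_]; first by rewrite i0 in oi.
exists 0%N => //; exists ((m i)%:R^-1 *: \sum_(f <- fs) f); last by rewrite tail0n.
right; exists fs => //; split=> //; split; first by move=> g /ht; apply: stage1_mono; lia.
split; first by exists k; split=> //; apply: stage2_mono h1; lia.
move=> l /andP[l0 ls]; apply: (@stage2_mono t2); first lia.
exact: h2.
Qed.

Lemma L_tail p f : L f -> withzero L (tail p f).
Proof.
case=> s _; elim: s f p => [|s IH] f p.
  by move=> h; case: (F_all_tail p h) => ->; [left; exact: L_F_all|right].
rewrite stage1E => -[/IH//|[i _ h]]; have i1 := stage2_pos h; move: h; rewrite stage2E.
case: eqP => [i0|_]; first by rewrite i0 in i1.
have even_avg : ~~ odd i -> averages m n i (all_in (stage s).1) f -> withzero L (tail p f).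
  move=> ei /averagesW a.
  have {}a : waverages i L (tail p f) by apply: waverages_tail a => g; exact: IH.
  have [f0|/eqP f0] := eqVneq (tail p f) 0; first by right.
  by left; apply: (@Lweight_L i); apply: L_even_avg => //; exact: waverages_nz.
case: ifP => oi.
  move=> h; left; exists s.+2 => //; apply: (@stage21 _ i); rewrite stage2E oi.
  case: eqP => [i0|_]; first by rewrite i0 in i1.
  by exists p => //; exists f => //; left; left; rewrite stage2E oi; case: eqP => // i0; lia.
case=> [[|[g]]|]; last by apply: even_avg; rewrite oi.
- by move=> /stage21; exact: IH.
- move=> /stage21/(IH _ p) h <-; rewrite tailN; case: h => [/L_opp|->]; first by left.
  by right; rewrite oppr0.
Qed.

(** The signs and tails accumulated over the stages collapse to one sign and one
    tail. They are kept in front of the sum, because the coding constrains the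
    special sequence itself and not its tails. *)
Lemma Lweight_oddP i f : odd i -> Lweight i f -> exists (b : bool) p fs,
  [/\ (size fs <= n i)%N, successive fs, all_in L fs, special n sigma Lweight i fs &
      f = (-1) ^+ b *: tail p ((m i)%:R^-1 *: \sum_(g <- fs) g)].
Proof.
move=> oi [s _]; elim: s f => // s IH f; rewrite stage2E oi; case: eqP => // _.
case=> q _ [g + <-] => -[[/IH|[h /IH]]|].
- move=> [b [p [fs [sz su Lfs sp ->]]]]; exists b, (maxn q p), fs; split=> //.
  rewrite tailZ; congr (_ *: _); apply: c00P => k; rewrite !tailE leq_max.
  by case: ltnP => //; case: ltnP.
- move=> [b [p [fs [sz su Lfs sp ->]]]] <-; exists (~~ b), (maxn q p), fs; split=> //.
  rewrite tailN tailZ -scaleNr; congr (_ *: _); first by case: b => /=; rewrite ?expr0 ?expr1 ?opprK.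
  apply: c00P => k; rewrite !tailE leq_max.
  by case: ltnP => //; case: ltnP.
- move=> [fs [/andP[_ sz] su [Lfs [[k [nk h1]] h2]]] <-]; exists false, q, fs.
  split=> //; last by rewrite expr0 scale1r.
    by move=> h /Lfs; exists s.
  split; first by exists k; split=> //; exists s.
  by move=> l /h2; exists s.
Qed.

(** For estimates of absolute values the sign and the tail are moved inside the sum. *)
Lemma Lweight_waverages i f : Lweight i f -> waverages i L f.
Proof.
have [oi|ei] := boolP (odd i).
  move=> /(Lweight_oddP oi)[b [p [fs [sz su Lfs _ ->]]]].
  have a : waverages i L (tail p ((m i)%:R^-1 *: \sum_(g <- fs) g)).
    apply: (@waverages_tail p i L) => [g|]; first exact: L_tail.
    exists fs; split=> //; first exact: successiveW.
    by move=> g /Lfs; left.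
  case: b; rewrite ?expr0 ?expr1 ?scale1r ?scaleN1r//.
  by apply: waverages_opp a; exact: L_opp.
case=> s _; elim: s f => // s IH f; rewrite stage2E (negbTE ei); case: eqP => // _.
case=> [[/IH//|[g /IH a <-]]|/averagesW a]; first by apply: waverages_opp a; exact: L_opp.
by apply: waverages_sub a => g; left; exists s.
Qed.

(** Since K is closed under signs and tails, L is contained in K up to zero; this
    gives access to the coding, which is only constrained on sequences in K. *)
Lemma stage_K s : (stage s).1 `<=` withzero K /\
  forall i f, (stage s).2 i f -> waverages i K f.
Proof.
have Kopp g : K g -> K (- g) by case/K_opp_tail.
have KT p g : K g -> withzero K (tail p g) by case/K_opp_tail.
elim: s => [|s [IH1 IH2]]; first by split=> // f; left; exact: K_F_all.
have a2 i f : (stage s.+1).2 i f -> waverages i K f.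
  have pm g : plus_minus ((stage s).2 i) g -> waverages i K g.
    by case=> [/IH2//|[h /IH2 a <-]]; apply: waverages_opp a.
  rewrite stage2E; case: eqP => // _; case: ifP => _; last first.
    by case=> [/pm//|/averagesW]; exact: waverages_sub.
  case=> q _ [g hg <-]; apply: (@waverages_tail _ _ K) => [h|]; first exact: KT.
  case: hg => [/pm//|[fs [sz su [Lfs _]] <-]].
  by apply: (waverages_sub IH1); apply: averagesW; exists fs.
split=> // f; rewrite stage1E => -[/IH1//|[i _ h]].
have [->|/eqP f0] := eqVneq f 0; [by right|left].
by apply: K_waverages f0; [exact: stage2_pos h|exact: a2 h].
Qed.

Lemma L_K f : L f -> f <> 0 -> K f.
Proof. by case=> s _ /(proj1 (stage_K s))[]. Qed.

Lemma L_ball f : L f -> dual_ball00 f.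
Proof. by case=> s _ /(proj1 (stage_K s))[/K_ball//|->]; exact: dual_ball00_0. Qed.

Lemma LZ_ball f : withzero L f -> dual_ball00 f.
Proof. by case=> [/L_ball//|->]; exact: dual_ball00_0. Qed.

Lemma LZ_tail p f : withzero L f -> withzero L (tail p f).
Proof. by case=> [/(L_tail p)//|->]; right; rewrite tail_0. Qed.

Lemma Lweight_Astar i f : (1 <= i)%N -> Lweight i f -> f <> 0 -> Astar m n F i f.
Proof.
move=> i1 [s _ /(proj2 (stage_K s)) a] f0; rewrite /Astar; case: eqP => [|_]; first lia.
exact: waverages_nz.
Qed.

Lemma Lweight_pos i f : Lweight i f -> (1 <= i)%N.
Proof. by case=> s _ /stage2_pos. Qed.

(** The coordinates of a functional of [Astar k] are bounded by 1/m_k, so that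
    a nonzero functional lies in finitely many of these sets only. *)
Lemma jmax_ge i f : f <> 0 -> Astar m n F i f -> (i <= jmax m n F f)%N.
Proof.
move=> /nz_supp[c /eqP fc] Ai.
have [v fv] : exists v, f c v <> 0.
  by apply: contrapT => h; apply: fc; apply/funext => v; apply: contrapT => fv; apply: h; exists v.
have fv0 : 0 < `|f c v| by rewrite normr_gt0; exact/eqP.
have bd k : Astar m n F k f -> (k <= Num.bound (`|v| / `|f c v|))%N.
  rewrite /Astar; case: eqP => [->//|/eqP]; rewrite -lt0n => k1.
  case=> gs [_ /successiveW s Kgs] fE; rewrite leqNgt; apply/negP => kb.
  have m0 : 0 < (m k)%:R :> R by rewrite ltr0n (leq_trans _ (m_ge2 hmn k1)).
  have : `|f c v| <= (m k)%:R^-1 * `|v|.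
    rewrite -fE c00Z; case: (wsuccessive_coord c s) => [->|[g ggs ->]].
      by rewrite scaler0 normr0 mulr_ge0// invr_ge0 ltW.
    change (`|(m k)%:R^-1 * g c v| <= (m k)%:R^-1 * `|v|).
    rewrite normrM gtr0_norm ?invr_gt0// ler_pM2l ?invr_gt0//.
    by have [_] := K_ball (Kgs _ ggs) c; exact.
  apply/negP; rewrite -ltNge mulrC ltr_pdivrMr// mulrC -ltr_pdivrMr//.
  rewrite (lt_le_trans (archi_boundP _)) ?divr_ge0//.
  rewrite ler_nat (leq_trans (ltnW kb))// (leq_trans _ (m_exp hmn k1))//.
  by rewrite ltnW// ltn_expl.
pose P := [pred k | `[< Astar m n F k f >]].
have exP : exists k, P k by exists i; exact/asboolP.
have bP k : P k -> (k <= Num.bound (`|v| / `|f c v|))%N by move=> /asboolP/bd.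
rewrite /jmax; case: xgetP => [j _ [_ /(_ i Ai)]//|h].
case: (ex_maxnP exP bP) => j /asboolP Aj jm; exfalso; apply: (h j); split=> // k Ak.
by apply: jm; exact/asboolP.
Qed.

Lemma take_Kseq gs l : successive gs -> all_in L gs -> (0 < l <= size gs)%N ->
  Kseq m n F (take l gs).
Proof.
move=> su Lgs /andP[l0 ls]; split.
- by move=> /(congr1 size); rewrite size_takel// => l00; rewrite l00 in l0.
- case/andP: su => a s; apply/andP; split; first by apply/allP => g /mem_take; exact: (allP a).
  exact: take_sorted.
- move=> g /mem_take gg; apply: L_K; first exact: Lgs.
  exact: successive_nz gg.
Qed.

(** Weights along a special sequence: they are prescribed by the coding, and
    exceed 2 n_j by its monotonicity. *)
Lemma special_weights j gs r : successive gs -> all_in L gs -> special n sigma Lweight j gs ->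
  (r < size gs)%N ->
  exists v, [/\ ((n j).+1.*2 <= v)%N, Lweight v (nth 0 gs r) &
    (0 < r)%N -> v = sigma (take r gs)].
Proof.
move=> su Lgs [[k [nk h1]] h2]; case: hsigma => _ _ sj smono.
have Kt l := @take_Kseq gs l su Lgs.
elim: r => [|r IH] rs; first by exists (2 * k)%N; split=> //; lia.
have [v [vb hv vr]] := IH (ltnW rs).
exists (sigma (take r.+1 gs)); split=> //; last by apply: h2.
apply: (leq_trans vb); rewrite (take_nth 0) ?(ltnW rs)//.
case: r rs vr hv IH => [|r] rs vr hv _.
  have gn : nth 0 gs 0 <> 0 by apply: successive_nz (mem_nth _ _) => //; exact: ltnW.
  rewrite take0 /=; apply: leq_trans (jmax_ge gn (Lweight_Astar (Lweight_pos hv) hv gn)) _.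
  by apply/ltnW/sj => //; apply: L_K => //; apply: Lgs; apply: mem_nth; exact: ltnW.
rewrite (vr isT); apply: ltnW; apply: smono.
  by move=> /(congr1 size); rewrite size_takel// ltnW// ltnW.
by rewrite -take_nth ?(ltnW rs)//; apply: Kt; rewrite (ltnW rs).
Qed.

End NormingSet.

(** * The norm, and functionals against successive vectors *)

Section NormEstimates.
Context {R : realType} {X : nat -> completeNormedModType R}.
Context {m n : nat -> nat} {F : forall k, set (X k -> R^o)}.
Context {sigma : seq (functional X) -> nat}.
Context {Z : completeNormedModType R} {iota : {linear Omega00 X -> Z}}.
Hypotheses (hmn : parameters m n) (hF : forall k, norming_set (@F k)).
Hypothesis hZ : is_d_product m n F sigma iota.
Implicit Types (f g : functional X) (fs gs : seq (functional X)) (x y : Omega00 X).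

Notation L := (Lset m n F sigma).
Notation LZ := (withzero L).
Local Notation N x := `|iota x|.

Lemma norm_le x (B : R) : (forall f, L f -> eval00 f x <= B) -> N x <= B.
Proof.
move=> h; rewrite -lee_fin (proj1 hZ x); apply: ge_ereal_sup => _ [f Lf <-].
by rewrite lee_fin h.
Qed.

Lemma eval_le f x : LZ f -> `|eval00 f x| <= N x.
Proof.
have h g : L g -> eval00 g x <= N x.
  by move=> Lg; rewrite -lee_fin (proj1 hZ x); apply: ereal_sup_ubound; exists g.
case=> [Lf|->]; last by rewrite eval0l normr0.
rewrite ler_norml h// andbT -lerN2 opprK -evalNl h//.
exact: (L_opp hF).
Qed.

Lemma norm_attain x (r : R) : r < N x -> exists2 f, L f & r < eval00 f x.
Proof.
move=> rx; apply: contrapT => h; have : N x <= r.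
  by apply: norm_le => f Lf; rewrite leNgt; apply/negP => fr; apply: h; exists f.
by rewrite leNgt rx.
Qed.

Lemma normZ a x : N (a *: x) = `|a| * N x.
Proof. by rewrite linearZ normrZ. Qed.

Lemma coord_functional x k : x k <> 0 ->
  exists2 f, F_all F f & 0 < eval00 f x /\ forall y, y k = 0 -> eval00 f y = 0.
Proof.
move=> xk; have [v Fv vx] : exists2 v, F v & 0 < v (x k).
  apply: contrapT => h; case: (hF k) => _ _ _ /(_ (x k)) e.
  have : `|x k| <= 0.
    rewrite -lee_fin e; apply: ge_ereal_sup => _ [v Fv <-]; rewrite lee_fin leNgt.
    by apply/negP => v0; apply: h; exists v.
  by rewrite normr_le0 => /eqP.
pose s := single (E := fun k => (X k -> R^o) : lmodType R) v.
have Fs : F_all F s by exists k => //; exists v.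
have si : s k = v := single_in v.
have so j : j <> k -> s j = 0 by exact: single_coord.
have sE y : eval00 s y = v (y k).
  rewrite (@eval00E _ _ k.+1) => [|j kj]; last by apply: so; lia.
  rewrite (bigD1 ord_max)// big1 => [|i /eqP ik]; last first.
    by have -> : s i = 0 by apply: so => e; apply: ik; apply: ord_inj; rewrite e.
  by change (s k (y k) + 0 = v (y k)); rewrite addr0 si.
exists s => //; rewrite sE; split=> // y yk; rewrite sE yk.
by have := F_all_ball hF Fs; move=> /(@dual_ball00_at0 _ _ s k); rewrite si.
Qed.

Lemma norm_gt0 x : x <> 0 -> 0 < N x.
Proof.
move=> /nz_supp[k /eqP xk]; have [f Ff [fx _]] := coord_functional xk.
apply: (lt_le_trans fx); rewrite (le_trans (ler_norm _))//.
by apply: eval_le; left; exact: L_F_all.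
Qed.

Lemma norm_tail p x : N (tail p x) <= N x.
Proof.
apply: norm_le => f Lf; rewrite -eval_tail; last exact: (L_ball hmn hF Lf).
by rewrite (le_trans (ler_norm _))//; apply: eval_le; exact: (L_tail hF).
Qed.

Definition evals gs x := \sum_(g <- gs) eval00 g x.

Definition Lsuccessive gs := wsuccessive gs /\ forall g, g \in gs -> LZ g.

Lemma Lsuccessive_cons g gs : Lsuccessive (g :: gs) ->
  [/\ LZ g, Lsuccessive gs & forall h, h \in gs -> supp_lt g h].
Proof.
case=> /wsuccessive_cons[gh s] Lg; split=> //; first by apply: Lg; rewrite mem_head.
by split=> // h hgs; apply: Lg; rewrite inE hgs orbT.
Qed.

Let bLZ f : LZ f -> dual_ball00 f. Proof. exact: (LZ_ball hmn hF). Qed.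

Lemma evals_cons g gs x : evals (g :: gs) x = eval00 g x + evals gs x.
Proof. by rewrite /evals big_cons. Qed.

Lemma evalsD gs x y : Lsuccessive gs -> evals gs (x + y) = evals gs x + evals gs y.
Proof.
move=> [_ Lg]; rewrite /evals -big_split; apply: eq_big_seq => g /Lg/bLZ bg.
exact: evalDr.
Qed.

Lemma evalsZ gs a x : Lsuccessive gs -> evals gs (a *: x) = a * evals gs x.
Proof.
move=> [_ Lg]; rewrite /evals mulr_sumr; apply: eq_big_seq => g /Lg/bLZ bg.
exact: evalZr.
Qed.

Lemma evals0 gs x : (forall g, g \in gs -> eval00 g x = 0) -> evals gs x = 0.
Proof. by move=> h; rewrite /evals big_seq big1. Qed.

Lemma evals_le gs x (C : R) : Lsuccessive gs -> N x <= C -> `|evals gs x| <= (size gs)%:R * C.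
Proof.
move=> [_ Lg] xC; rewrite /evals (le_trans (ler_norm_sum _ _ _))//.
rewrite mulr_natl -(sum1_size gs) -sumrMnr big_seq [leRHS]big_seq ler_sum// => g gg.
by rewrite mulr1n (le_trans (eval_le _ (Lg _ gg))).
Qed.

(** A vector supported on B - a coordinates is met by at most B - a members of a
    successive family. *)
Lemma evals_count gs x a B : Lsuccessive gs -> supp_in a B x -> `|evals gs x| <= (B - a)%:R * N x.
Proof.
elim: gs x a => [|g gs IH] x a lg wx; first by rewrite /evals big_nil normr0 mulr_ge0.
have [Lg lgs gh] := Lsuccessive_cons lg; rewrite evals_cons.
have [gx0|gx] := eqVneq (eval00 g x) 0; first by rewrite gx0 add0r IH.
have [p [gp xp]] : exists p, g p <> 0 /\ x p <> 0.
  apply: contrapT => h; case/eqP: gx; apply: eval_disj; first exact: bLZ.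
  move=> k; have [->|/eqP gk] := eqVneq (g k) 0; [by left|right].
  by apply: contrapT => xk; apply: h; exists k.
have pB : (a <= p < B)%N.
  by apply/negPn/negP => h; apply: xp; apply: wx; lia.
have -> : evals gs x = evals gs (tail p.+1 x).
  apply: eq_big_seq => h hg; rewrite -eval_tail; last by apply: bLZ; case: lgs => _; exact.
  congr eval00; apply/esym/tail_id => k kp.
  apply: contrapT => hk; move/supp_ltP: (gh h hg) => /(_ p k gp hk); lia.
have w2 : supp_in p.+1 B (tail p.+1 x).
  move=> k /orP[kp|kB]; rewrite tailE; first by rewrite kp.
  by case: ifP => // _; apply: wx; lia.
have := IH _ _ lgs w2; have := eval_le x Lg; have := norm_tail p.+1 x => h1 h2 h3.
have -> : (B - a)%:R = (B - p.+1)%:R + 1 + (p - a)%:R :> R.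
  by rewrite natr1 -natrD; congr _%:R; clear -pB; lia.
rewrite (le_trans (ler_normD _ _))//.
have : 0 <= (p - a)%:R * N x by rewrite mulr_ge0.
have : (B - p.+1)%:R * N (tail p.+1 x) <= (B - p.+1)%:R * N x by rewrite ler_wpM2l.
by lra.
Qed.

(** Flatness controls sums of up to M successive elements of L, not only
    single ones; dividing by m_i it bounds x uniformly on functionals of weight
    i whenever n_i <= M. *)
Definition flat (M : nat) (C : R) x :=
  forall gs, (size gs <= M)%N -> Lsuccessive gs -> `|evals gs x| <= C.

Lemma flat_le M C x g : (1 <= M)%N -> flat M C x -> LZ g -> `|eval00 g x| <= C.
Proof.
move=> M1 /(_ [:: g] M1) h Lg; have : Lsuccessive [:: g].
  by split=> // h'; rewrite inE => /eqP ->.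
by move=> /h; rewrite evals_cons /evals big_nil addr0.
Qed.

Lemma flat_norm M C x : (1 <= M)%N -> flat M C x -> N x <= C.
Proof.
move=> M1 h; apply: norm_le => f Lf; rewrite (le_trans (ler_norm _))//.
by apply: flat_le h _ => //; left.
Qed.

Lemma flat_sub M M' C C' x : (M' <= M)%N -> C <= C' -> flat M C x -> flat M' C' x.
Proof. by move=> MM CC h gs sgs lg; rewrite (le_trans _ CC)// h// (leq_trans sgs). Qed.

Lemma flat_scale M C x a : flat M C x -> flat M (`|a| * C) (a *: x).
Proof. by move=> h gs sgs lg; rewrite evalsZ// normrM ler_wpM2l// h. Qed.

Lemma waverages_eval i f x : waverages m n i L f ->
  exists gs, [/\ (size gs <= n i)%N, Lsuccessive gs & eval00 f x = (m i)%:R^-1 * evals gs x].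
Proof.
case=> gs [sz s Lg ->]; exists gs; split=> //.
by rewrite evalZl eval_suml.
Qed.

Lemma waverages_flat i f x M C : (1 <= i)%N -> waverages m n i L f -> (n i <= M)%N -> flat M C x ->
  `|eval00 f x| <= (m i)%:R^-1 * C.
Proof.
move=> i1 /(@waverages_eval _ _ x)[gs [sz lg ->]] iM h.
rewrite normrM ger0_norm ?invr_ge0// ler_wpM2l ?invr_ge0// h//.
exact: leq_trans iM.
Qed.

Lemma waverages_count i f x a B : waverages m n i L f -> supp_in a B x ->
  `|eval00 f x| <= (m i)%:R^-1 * (B%:R * N x).
Proof.
move=> /(@waverages_eval _ _ x)[gs [sz lg ->]] wx.
rewrite normrM ger0_norm ?invr_ge0// ler_wpM2l ?invr_ge0//.
by rewrite (le_trans (evals_count lg wx))// ler_wpM2r// ler_nat leq_subr.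
Qed.

Lemma functional_end g : exists c, (forall k, (c <= k)%N -> g k = 0) /\
  (forall h, supp_lt g h -> forall k, (k < c)%N -> h k = 0).
Proof.
pose P := [pred c | `[< forall k, (c <= k)%N -> g k = 0 >]].
have exP : exists c, P c by have [B gB] := supp_bound g; exists B; exact/asboolP.
case: (ex_minnP exP) => c /asboolP gc cm; exists c; split=> // h /supp_ltP gh k kc.
apply: contrapT => hk; case: c gc cm kc => // c gc cm kc.
have [gc0|/eqP gc0] := eqVneq (g c) 0; last by have := gh c k gc0 hk; lia.
suff : P c by move=> /cm; lia.
by apply/asboolP => j; rewrite leq_eqVlt => /orP[/eqP <-//|]; exact: gc.
Qed.

(** Successive functionals against successive vectors: each of the functionals
    keeps an interval of vectors for itself, and at most one vector is shared
    with its successors; on the latter only flatness is available. *)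
Lemma evals_blocks a u M (A B C : R) gs i b :
  blocks a u -> (forall k, flat M C (u k)) -> 0 <= A -> 0 <= B -> 0 <= C ->
  (size gs <= M)%N -> Lsuccessive gs ->
  (forall g i b, g \in gs -> (i <= b)%N ->
     `|eval00 g (\sum_(i <= k < b) u k)| <= A * (b - i)%:R + B) ->
  (i <= b)%N ->
  `|evals gs (\sum_(i <= k < b) u k)| <= A * (b - i)%:R + (size gs)%:R * (B + C).
Proof.
move=> bu fu A0 B0 C0; elim: gs i => [|g gs IH] i sz lg hg ib.
  by rewrite /evals big_nil normr0 mul0r addr0 mulr_ge0.
have [Lg lgs gh] := Lsuccessive_cons lg; have bg := bLZ Lg.
have [c [gc hc]] := functional_end g.
have bgs h : h \in gs -> dual_ball00 h by case: lgs => _ H /H/bLZ.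
pose P := [pred p | (i <= p)%N && ((b <= p)%N || (c < a p.+1)%N)].
have exP : exists p, P p by exists b; rewrite /= ib leqnn.
case: (ex_minnP exP) => p /andP[ip bp] pm.
have pb : (p <= b)%N by apply: pm; rewrite /= ib leqnn.
have lo k : (i <= k < p)%N -> (a k.+1 <= c)%N.
  by move=> /andP[ik kp]; rewrite leqNgt; apply/negP => h; have := pm k; rewrite /= ik h orbT; lia.
have gs_lo : evals gs (\sum_(i <= k < p) u k) = 0.
  apply: evals0 => h hgs; rewrite (eval_sumr _ _ (bgs h hgs)) big_nat big1// => k kp.
  apply: (@eval_before _ _ _ _ (a k) (a k.+1)); [exact: bgs|by case: bu|].
  by move=> j jk; apply: hc; [exact: gh|have := lo k kp; lia].
have hgg : `|eval00 g (\sum_(i <= k < p) u k)| <= A * (p - i)%:R + B.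
  by apply: hg => //; rewrite mem_head.
have szr : (size (g :: gs))%:R = 1 + (size gs)%:R :> R by rewrite /= -nat1r.
have [pb'|bp'] := ltnP p b; last first.
  have pbe : p = b by lia.
  rewrite -pbe evals_cons gs_lo addr0 (le_trans hgg)// lerD2l szr mulrDl mul1r.
  have : 0 <= (size gs)%:R * (B + C) by rewrite mulr_ge0// addr_ge0.
  by lra.
have {}bp : (c < a p.+1)%N by case/orP: bp => //; lia.
have -> : \sum_(i <= k < b) u k =
    \sum_(i <= k < p) u k + (u p + \sum_(p.+1 <= k < b) u k).
  by rewrite -big_ltn// -big_cat_nat.
rewrite (evalsD _ _ lg) (evalsD _ _ lg) evals_cons gs_lo addr0.
have -> : evals (g :: gs) (\sum_(p.+1 <= k < b) u k) = evals gs (\sum_(p.+1 <= k < b) u k).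
  rewrite evals_cons (eval_sumr _ _ bg) big_nat big1 ?add0r// => k /andP[pk kb].
  apply: eval_disj => // j; have [cj|jc] := leqP c j; [by left; exact: gc|right].
  by case: (bu) => _ w; apply: (w k); have := blocks_mono bu pk; lia.
have hg' h j l : h \in gs -> (j <= l)%N ->
    `|eval00 h (\sum_(j <= k < l) u k)| <= A * (l - j)%:R + B.
  by move=> hh; apply: hg; rewrite inE hh orbT.
have h1 := IH p.+1 (ltnW sz) lgs hg' pb'; have h2 := fu p _ sz lg; rewrite (le_trans (ler_normD _ _))//.
have h3 := ler_normD (evals (g :: gs) (u p)) (evals gs (\sum_(p.+1 <= k < b) u k)).
have -> : (b - i)%:R = (p - i)%:R + 1 + (b - p.+1)%:R :> R.
  by rewrite natr1 -natrD; congr _%:R; clear -ip pb'; lia.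
rewrite szr; lra.
Qed.

(** Estimate by iterated cutting. A functional of weight smaller than j0 is cut
    into its n_i <= M pieces, which costs a factor 1/m_i <= 1/2; after l rounds
    the pieces of large weight, for which a good bound d per vector is assumed,
    contribute d, the others at most C/2^l, per vector, and the number M^l of
    pieces bounds the number of exceptional terms. *)
Lemma iterated_cut a u M (C B d : R) j0 :
  blocks a u -> (forall k, flat M C (u k)) -> (1 <= M)%N ->
  0 <= C <= B -> 0 <= d ->
  (forall i, (1 <= i < j0)%N -> (n i <= M)%N) ->
  (forall g, L g -> [\/ F_all F g, exists i, (1 <= i < j0)%N /\ waverages m n i L g |
     forall i b, (i <= b)%N ->
      `|eval00 g (\sum_(i <= k < b) u k)| <= d * (b - i)%:R + B]) ->
  forall l g i b, LZ g -> (i <= b)%N ->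
    `|eval00 g (\sum_(i <= k < b) u k)| <= (C / 2 ^+ l + d) * (b - i)%:R + B * M%:R ^+ l.
Proof.
move=> bu fu M1 /andP[C0 CB] d0 nM H.
have C1 k g : LZ g -> `|eval00 g (u k)| <= C by apply: flat_le (fu k).
have B0 : 0 <= B by lra.
have triv g i b : LZ g -> (i <= b)%N ->
    `|eval00 g (\sum_(i <= k < b) u k)| <= C * (b - i)%:R.
  move=> Lg ib; rewrite eval_sumr; last exact: bLZ.
  rewrite (le_trans (ler_norm_sum _ _ _))// mulr_natr -sumr_const_nat ler_sum_nat// => k _.
  exact: C1.
have Ml l : 1 <= M%:R ^+ l :> R by rewrite exprn_ege1// ler1n.
elim=> [|l IH] g i b Lg ib.
  rewrite expr0 divr1 (le_trans (triv _ _ _ Lg ib))// expr0 mulr1.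
  have : 0 <= d * (b - i)%:R by rewrite mulr_ge0.
  lra.
have p2 : 0 < 2 ^+ l :> R by rewrite exprn_gt0.
have bi0 : 0 <= (b - i)%:R :> R by [].
have cl0 : 0 <= C / 2 ^+ l by rewrite divr_ge0// ltW.
have cl : C / 2 ^+ l.+1 = C / 2 ^+ l / 2 by rewrite exprS invfM; lra.
have r1 : 0 <= (C / 2 ^+ l.+1) * (b - i)%:R by rewrite mulr_ge0// cl; lra.
have r2 : 0 <= d * (b - i)%:R by rewrite mulr_ge0.
have BM : B <= B * M%:R ^+ l.+1 by rewrite ler_peMr.
case: Lg => [Lg|->]; last first.
  by rewrite eval0l normr0 addr_ge0// ?mulrDl ?addr_ge0// mulr_ge0// (le_trans ler01).
case: (H _ Lg) => [Fg|[j [j0j ag]]|hg]; last first.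
- by rewrite (le_trans (hg _ _ ib))// mulrDl; lra.
- have [gs [sz lg ->]] := waverages_eval (\sum_(i <= k < b) u k) ag.
  have j1 : (1 <= j)%N by case/andP: j0j.
  have szM : (size gs <= M)%N by apply: leq_trans sz (nM _ j0j).
  have lgL h : h \in gs -> LZ h by case: lg => _; exact.
  have AA : 0 <= C / 2 ^+ l + d by rewrite addr_ge0.
  have BB : 0 <= B * M%:R ^+ l by rewrite mulr_ge0// (le_trans ler01).
  have := @evals_blocks a u M _ _ C gs i b bu fu AA BB C0 szM lg
    (fun h i' b' hh => IH h i' b' (lgL h hh)) ib.
  move=> h; have [mj0 mj2] : 0 < (m j)%:R^-1 :> R /\ (m j)%:R^-1 <= 2^-1 :> R.
    have := m_ge2 hmn j1 => m2.
    have m0 : 0 < (m j)%:R :> R by rewrite ltr0n (leq_trans _ m2).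
    by rewrite invr_gt0 m0 lef_pV2 ?posrE// ler_nat.
  rewrite normrM gtr0_norm//.
  have h2 : (size gs)%:R * (B * M%:R ^+ l + C) <= 2 * (B * M%:R ^+ l.+1).
    have s1 : (size gs)%:R * (B * M%:R ^+ l + C) <= M%:R * (B * M%:R ^+ l + C).
      by rewrite ler_wpM2r ?ler_nat// addr_ge0.
    apply: (le_trans s1); rewrite exprS mulrDr.
    have : M%:R * C <= M%:R * (B * M%:R ^+ l).
      by rewrite ler_wpM2l// (le_trans CB)// ler_peMr.
    lra.
  rewrite (@le_trans _ _ (2^-1 * ((C / 2 ^+ l + d) * (b - i)%:R + 2 * (B * M%:R ^+ l.+1))))//.
    apply: ler_pM; [exact: ltW|exact: normr_ge0|exact: mj2|by rewrite (le_trans h)// lerD2l].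
  rewrite cl mulrDl in r1 *; move: r1; rewrite mulrDr mulrDl; lra.
(* g lives on one coordinate, where at most one of the vectors is nonzero *)
- have [q gq] : exists q, forall k, k != q -> eval00 g (u k) = 0.
    case: Fg => c _ [v Fv vg]; case: (pselect (exists q, u q c <> 0)) => [[q uq]|nq].
      exists q => k kq; apply: eval_disj; first by apply: bLZ; left.
      move=> j; have [->|/eqP jc] := eqVneq j c; last by left; rewrite -vg single_coord.
      right; apply: contrapT => uk.
      by move/eqP: kq; apply; apply: (blocks_index bu bu uk uq).
    exists 0%N => k _; apply: eval_disj; first by apply: bLZ; left.
    move=> j; have [->|/eqP jc] := eqVneq j c; last by left; rewrite -vg single_coord.
    by right; apply: contrapT => h; apply: nq; exists k.
  apply: (@le_trans _ _ B); last by rewrite mulrDl; lra.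
  rewrite eval_sumr; last by apply: bLZ; left.
  have [qb|qb] := boolP (q \in index_iota i b); last first.
    rewrite big_seq big1 ?normr0// => k kb; apply: gq.
    by apply: contraNneq qb => <-.
  rewrite (bigD1_seq q) ?iota_uniq//= big1 ?addr0; last by move=> k; exact: gq.
  by rewrite (le_trans _ CB)// C1//; left.
Qed.

End NormEstimates.

(** * Averages with the l_1 behaviour *)

Section RichSubspaces.
Context {R : realType} {X : nat -> completeNormedModType R}.
Implicit Types (U : set (Omega00 X)) (x y : Omega00 X).

(** What remains of an infinite dimensional subspace of a block subspace after a small
    perturbation. *)
Definition rich U :=
  (forall (c : R) x y, U x -> U y -> U (c *: x + y)) /\
  forall p, exists x, [/\ U x, x <> 0 & forall k, (k < p)%N -> x k = 0].

Lemma rich0 U : rich U -> U 0.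
Proof.
by move=> [lU rU]; have [x [Ux _ _]] := rU 0%N; have := lU (-1) x x Ux Ux;
  rewrite scaleN1r addNr.
Qed.

Lemma richZ U c x : rich U -> U x -> U (c *: x).
Proof. by move=> rU Ux; rewrite -(addr0 (c *: x)); apply: rU.1 => //; exact: rich0. Qed.

Lemma rich_sum U (I : Type) (r : seq I) (u : I -> Omega00 X) :
  rich U -> (forall i, U (u i)) -> U (\sum_(i <- r) u i).
Proof.
move=> rU Uu; elim/big_ind: _ => // [|x y Ux Uy]; first exact: rich0.
by rewrite -(scale1r x); exact: rU.1.
Qed.

Lemma biorthogonal_sum a (f : nat -> functional X) (u : nat -> Omega00 X) N :
  blocks a f -> blocks a u -> (forall k, dual_ball00 (f k)) ->
  eval00 (\sum_(g <- mkseq f N) g) (\sum_(0 <= k < N) u k) =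
  \sum_(0 <= k < N) eval00 (f k) (u k).
Proof.
move=> bf bu fb; rewrite eval_suml big_map [index_iota _ _]/(iota 0 (N - 0)) subn0.
apply: eq_big_seq => k kN.
rewrite (eval_sumr _ _ (fb k)) -{1}(subn0 N) (bigD1_seq k) ?iota_uniq ?subn0//=.
rewrite big1 ?addr0// => l lk; apply: eval_disj; first exact: fb.
move=> c; have [->|/eqP fc] := eqVneq (f k c) 0; [by left|right].
by apply: contrapT => uc; move/eqP: lk; apply; apply/esym/(blocks_index bf bu fc uc).
Qed.

End RichSubspaces.

Section Averages.
Context {R : realType} {X : nat -> completeNormedModType R}.
Context {m n : nat -> nat} {F : forall k, set (X k -> R^o)}.
Context {sigma : seq (functional X) -> nat}.
Context {Z : completeNormedModType R} {iota : {linear Omega00 X -> Z}}.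
Hypotheses (hmn : parameters m n) (hF : forall k, norming_set (@F k)).
Hypothesis hZ : is_d_product m n F sigma iota.
Implicit Types (f g : functional X) (fs gs : seq (functional X)) (x y : Omega00 X).
Implicit Type U : set (Omega00 X).

Notation L := (Lset m n F sigma).
Notation LZ := (withzero L).
Local Notation N x := `|iota x|.

Let Lball f (h : L f) : dual_ball00 f := LZ_ball hmn hF (or_introl h).

(** A functional of L that almost norms x, started where x starts; instead of
    cutting it off at the end of x, the next vector is taken beyond both. *)
Lemma norming_pair p x (r : R) : (forall k, (k < p)%N -> x k = 0) -> 0 <= r < N x ->
  exists f q, [/\ L f, f <> 0, r < eval00 f x, (p < q)%N & supp_in p q x /\ supp_in p q f].
Proof.
move=> px /andP[r0 rx]; have [f Lf fx] := norm_attain hZ rx.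
have tx : eval00 (tail p f) x = eval00 f x by rewrite (eval_tail _ _ (Lball Lf)) tail_id.
have f0 : tail p f <> 0 by move=> h; move: fx; rewrite -tx h eval0l; lra.
have [q1 pq1 w1] := exists_supp_in px.
have [|q2 pq2 w2] := @exists_supp_in _ _ p (tail p f); first by move=> k kp; rewrite tailE kp.
exists (tail p f), (maxn q1 q2); split=> //.
- by case: (L_tail hF p Lf).
- by rewrite tx.
- by rewrite leq_max pq1.
- by split; [apply: supp_in_sub w1|apply: supp_in_sub w2] => //; lia.
Qed.

Lemma pair_functional i a (f : nat -> functional X) : (forall k, L (f k)) -> (forall k, f k <> 0) ->
  blocks a f -> (1 <= i)%N -> ~~ odd i ->
  Lweight m n F sigma i ((m i)%:R^-1 *: \sum_(g <- mkseq f (n i)) g).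
Proof.
move=> Lf f0 bf i1 ei; apply: L_even_avg => //; exists (mkseq f (n i)) => //; split.
- by rewrite size_mkseq leqnn andbT; have := n_ge3 hmn i1; lia.
- by apply: (blocks_successive bf) => k _; exact: f0.
- by move=> _ /mapP[k _ ->].
Qed.

Lemma pair_eval a (f : nat -> functional X) (u : nat -> Omega00 X) M (c : R) :
  (forall k, L (f k)) -> blocks a f -> blocks a u ->
  eval00 (c *: \sum_(g <- mkseq f M) g) (\sum_(0 <= k < M) u k) =
  c * \sum_(0 <= k < M) eval00 (f k) (u k).
Proof.
move=> Lf bf bu; rewrite evalZl; congr (_ * _); apply: biorthogonal_sum bf bu _ => k.
exact: Lball.
Qed.

Lemma sum_groups (u : nat -> Omega00 X) (p K : nat) :
  \sum_(0 <= k < K) \sum_(k * p <= q < k.+1 * p) u q = \sum_(0 <= q < K * p) u q.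
Proof.
elim: K => [|K IH]; first by rewrite mul0n !big_geq.
rewrite big_nat_recr//= IH -big_cat_nat//; lia.
Qed.

(** In the tree of the successive averages of p terms, the norm cannot drop by the
    factor 2 at each of the t levels unless it drops by 2^t altogether. *)
Lemma pyramid U (p t : nat) : rich U -> (1 <= p)%N ->
  forall a (y : nat -> Omega00 X) (c : R),
  blocks a y -> (forall k, U (y k)) -> 0 <= c -> (forall k, N (y k) <= c) ->
  c * (p%:R / 2) ^+ t < N (\sum_(0 <= k < p ^ t) y k) ->
  exists b w (c' : R), [/\ blocks b w, (forall k, U (w k)), (forall k, N (w k) <= c'),
    (a 0 <= b 0)%N & 0 <= c' /\ c' * (p%:R / 2) < N (\sum_(0 <= k < p) w k)].
Proof.
move=> rU p1; elim: t => [|t IH] a y c bu Uy c0 Ny.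
  by rewrite expn0 big_nat1 expr0 mulr1 ltNge Ny.
move=> h; pose w k := \sum_(k * p <= q < k.+1 * p) y q; pose b k := a (k * p)%N.
have bw : blocks b w.
  split=> k; first by apply: (blocks_mono bu); lia.
  by apply: blocks_sum bu _; lia.
case: (pselect (exists k, c * (p%:R / 2) < N (w k))) => [[k hk]|nk].
  exists (fun q => a (k * p + q)%N), (fun q => y (k * p + q)%N), c; split=> //.
  - by case: bu => h1 h2; split=> q; rewrite addnS.
  - by rewrite addn0; apply: (blocks_mono bu); lia.
  split=> //; apply: (lt_le_trans hk); rewrite le_eqVlt; apply/orP; left; apply/eqP.
  rewrite /w; congr `|iota _|; rewrite -{1}[(k * p)%N]add0n big_addn.
  rewrite (_ : (k.+1 * p - k * p)%N = p); last lia.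
  by apply: eq_bigr => q _; rewrite addnC.
have [|||||b' [w' [c' [h1 h2 h3 h4 h5]]]] := IH b w (c * (p%:R / 2)).
- exact: bw.
- by move=> k; apply: rich_sum.
- by rewrite mulr_ge0// divr_ge0.
- by move=> k; rewrite leNgt; apply/negP => hk; apply: nk; exists k.
- rewrite sum_groups -expnSr; apply: le_lt_trans h.
  by rewrite exprS -!mulrA.
by exists b', w', c'; split=> //; rewrite (leq_trans _ h4)// /b mul0n.
Qed.

(** In an average of p vectors, p >= M^2, the at most M vectors shared by several of
    M successive functionals admit the same bound as all the others together. *)
Lemma flat_average p M a (w : nat -> Omega00 X) (c : R) :
  blocks a w -> (forall k, N (w k) <= c) -> 0 <= c -> (M ^ 2 <= p)%N -> (0 < p)%N ->
  flat (m := m) (n := n) (F := F) (sigma := sigma) M (c * (2 * p%:R)) (\sum_(0 <= k < p) w k).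
Proof.
move=> bw Nw c0 Mp p0 gs sgs lg.
have h k : flat (m := m) (n := n) (F := F) (sigma := sigma) M (M%:R * c) (w k).
  move=> hs shs lh; rewrite (le_trans (evals_le hF hZ lh (Nw k)))// ler_wpM2r// ler_nat//.
have hg g i b : g \in gs -> (i <= b)%N ->
    `|eval00 g (\sum_(i <= k < b) w k)| <= c * (b - i)%:R + 0.
  move=> gg ib; have Lg : LZ g by case: lg => _; exact.
  rewrite addr0 (le_trans (eval_le hF hZ _ Lg))// linear_sum /=.
  rewrite (le_trans (ler_norm_sum _ _ _))// mulr_natr -sumr_const_nat ler_sum_nat//.
have Mc : 0 <= M%:R * c by rewrite mulr_ge0.
have := evals_blocks hmn hF bw h c0 (lexx 0) Mc sgs lg hg (leq0n p).
move=> h1; apply: (le_trans h1); rewrite subn0 add0r.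
have : (size gs)%:R * (M%:R * c) <= M%:R * (M%:R * c) by rewrite ler_wpM2r// ler_nat.
have : M%:R * M%:R * c <= p%:R * c by rewrite ler_wpM2r// -natrM ler_nat mulnn.
lra.
Qed.

(** Averages that behave like those of the unit basis of l_1^p, p = n_j. Iterating
    averages of p terms halving the norms would bring the average of n_{j+1} unit
    vectors below 1 / (2 m_{j+1}), against the lower estimate given by the
    functionals of even weight j + 1. *)
Lemma l1_average U j p0 : rich U -> (2 <= j)%N -> odd j ->
  exists x, [/\ U x, (forall k, (k < p0)%N -> x k = 0), 1 < N x &
    flat (m := m) (n := n) (F := F) (sigma := sigma) (n j.-1) 4 x].
Proof.
move=> rU j2 oj.
pose P (hist : seq (Omega00 X * functional X)) p (yf : Omega00 X * functional X) q :=
  [/\ U yf.1, N yf.1 = 1, L yf.2, yf.2 <> 0 & [/\ 2^-1 < eval00 yf.2 yf.1, (p < q)%N,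
     supp_in p q yf.1 & supp_in p q yf.2]].
have [hist p|yf [a [a0 hyf]]] := @block_choice _ P p0.
  have [x [Ux x0 px]] := rU.2 p.
  have Nx : 0 < N x by exact: (norm_gt0 hF hZ).
  have Ny : N ((N x)^-1 *: x) = 1.
    by rewrite normZ ger0_norm ?invr_ge0 ?(ltW Nx)// mulVf// gt_eqF.
  have [||f [q [Lf f0 fx pq [w1 w2]]]] := @norming_pair p ((N x)^-1 *: x) 2^-1.
  - by move=> k kp; rewrite c00Z px// scaler0.
  - by rewrite Ny; lra.
  by exists ((N x)^-1 *: x, f), q; split=> //; exact: richZ.
pose y k := (yf k).1; pose f k := (yf k).2.
have by_ : blocks a y by split=> k; have [_ _ _ _ [_ /ltnW]] := hyf k.
have bf : blocks a f by split=> k; have [_ _ _ _ [_ /ltnW]] := hyf k.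
have Lf k : L (f k) by case: (hyf k).
have f0 k : f k <> 0 by case: (hyf k).
have j1 : (1 <= j)%N by lia.
have [t [nj mt]] := n_step hmn j1.
have nj1 : (1 <= n j)%N by have := n_ge3 hmn j1; lia.
have mj2 := m_ge2 hmn (i := j.+1) isT.
have big : 1 * ((n j)%:R / 2) ^+ t < N (\sum_(0 <= k < n j ^ t) y k).
  have Lh := pair_functional Lf f0 bf (i := j.+1) isT; rewrite /= negbK in Lh.
  have {}Lh := Lweight_L (Lh oj).
  have := pair_eval (n j.+1) (m j.+1)%:R^-1 Lf bf by_.
  have := eval_le hF hZ (\sum_(0 <= k < n j.+1) y k) (or_introl Lh).
  move=> h1 h2; rewrite -nj; apply: (lt_le_trans _ (le_trans (ler_norm _) h1)).
  rewrite h2 mul1r expr_div_n -natrX -nj -natrX.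
  have s1 : (n j.+1)%:R * 2^-1 < \sum_(0 <= k < n j.+1) eval00 (f k) (y k).
    rewrite mulr_natl -[X in _ *+ X]subn0 -sumr_const_nat ltr_sum_nat//.
      by have := n_ge3 hmn (i := j.+1) isT; lia.
    by move=> k _; have [_ _ _ _ [? _ _ _]] := hyf k.
  have m0 : 0 < (m j.+1)%:R :> R by rewrite ltr0n; lia.
  rewrite ltr_pdivlMl//; apply: le_lt_trans s1.
  rewrite mulrCA ler_wpM2l// ler_pdivrMr ?ltr0n ?expn_gt0//.
  have : (2 * m j.+1 <= 2 ^ t)%N.
    apply: (leq_trans _ (ltnW mt)); rewrite expnSr leq_mul2r; apply/orP; right.
    by rewrite expnS expn1; nia.
  rewrite -(ler_nat R) natrM natrX; lra.
have Uy k : U (y k) by case: (hyf k).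
have Ny k : N (y k) <= 1 by case: (hyf k) => _ ->.
have [b [w [c [bw Uw Nw ab [c0 hc]]]]] := pyramid rU nj1 by_ Uy ler01 Ny big.
set p := n j in nj nj1 hc.
have p0' : 0 < p%:R :> R by rewrite ltr0n.
have cp : 0 < c.
  rewrite lt_neqAle c0 andbT; apply/eqP => ce; move: hc; rewrite -ce mul0r ltNge.
  rewrite linear_sum (le_trans (ler_norm_sum _ _ _))// big1// => k _.
  by apply/eqP; rewrite eq_le normr_ge0 andbT ce Nw.
pose d := 2 / (c * p%:R).
have d0 : 0 < d by rewrite divr_gt0// mulr_gt0.
have dcp : d * (c * p%:R) = 2 by rewrite /d divfK// gt_eqF// mulr_gt0.
exists (d *: \sum_(0 <= k < p) w k); split.
- by apply: richZ => //; exact: rich_sum.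
- move=> k kp; rewrite c00Z (blocks_sum bw (leq0n p))// ?scaler0//.
  by apply/orP; left; rewrite (leq_trans kp)// -a0.
- rewrite normZ gtr0_norm//; apply: (@le_lt_trans _ _ (d * (c * (p%:R / 2)))); first lra.
  by rewrite ltr_pM2l.
- have Mp : (n j.-1 ^ 2 <= p)%N.
    rewrite /p; case: j j2 {oj nj nj1 mt mj2 big bw hc p p0' d d0 dcp j1} => // -[//|j] _ /=.
    have [s [-> hs]] := n_step hmn (i := j.+1) isT; apply: leq_pexp2l.
      by have := n_ge3 hmn (i := j.+1) isT; lia.
    have h8 : (2 ^ 3 <= m j.+2 ^ 3)%N by rewrite leq_exp2r// (m_ge2 hmn).
    rewrite leqNgt; apply/negP => s1; have : (2 ^ s <= 2 ^ 1)%N by rewrite leq_exp2l.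
    by move: (leq_trans h8 (ltnW hs)) => h1 /(leq_trans h1).
  apply: flat_sub (flat_scale hmn hF _ (flat_average bw Nw c0 Mp nj1)) => //.
  by rewrite gtr0_norm//; lra.
Qed.

End Averages.

(** * Exact pairs *)

Lemma sum_indicator (R : realType) (k0 i b : nat) :
  \sum_(i <= k < b) (k == k0)%:R <= 1 :> R.
Proof.
have [ib|ib] := boolP (k0 \in index_iota i b).
  by rewrite (bigD1_seq k0) ?iota_uniq//= eqxx big1 ?addr0// => k /negbTE ->.
rewrite big_seq big1 ?ler01// => k kb; case: eqP => // kk.
by rewrite -kk kb in ib.
Qed.

Lemma sum_exceptions (R : realType) (v : nat -> R) (E : seq nat) (d C : R) i b :
  0 <= C -> (forall k, k \notin E -> `|v k| <= d) -> (forall k, `|v k| <= C) -> 0 <= d ->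
  `|\sum_(i <= k < b) v k| <= d * (b - i)%:R + C * (size E)%:R.
Proof.
move=> C0 vd vC d0; rewrite (le_trans (ler_norm_sum _ _ _))//.
apply: (@le_trans _ _ (\sum_(i <= k < b) (d + C * \sum_(x <- E) (k == x)%:R))).
  apply: ler_sum_nat => k _; have [kE|kE] := boolP (k \in E); last first.
    by rewrite (le_trans (vd _ kE))// lerDl mulr_ge0// sumr_ge0.
  rewrite (le_trans (vC k))// (big_rem k)//= eqxx mulrDr mulr1.
  by rewrite addrCA lerDl addr_ge0// mulr_ge0// sumr_ge0.
have [ib|ib] := leqP i b; last first.
  rewrite big_geq ?(ltnW ib)// addr_ge0// mulr_ge0//.
rewrite big_split /= sumr_const_nat mulr_natr lerD2l -mulr_sumr.
rewrite ler_wpM2l// exchange_big /= -sum1_size natr_sum ler_sum// => x _.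
exact: sum_indicator.
Qed.

Lemma sum_one_exception (R : realType) (v : nat -> R) k0 (d C : R) i b :
  0 <= d -> 0 <= C -> (forall k, k <> k0 -> `|v k| <= d) -> (forall k, `|v k| <= C) ->
  `|\sum_(i <= k < b) v k| <= d * (b - i)%:R + C.
Proof.
move=> d0 C0 vd vC; have := @sum_exceptions R v [:: k0] d C i b C0 _ vC d0.
by rewrite mulr1; apply=> k; rewrite inE => /eqP; exact: vd.
Qed.

Lemma pow2_between (K : nat) : (1 <= K)%N -> exists l, (K <= 2 ^ l < 2 * K)%N.
Proof.
elim: K => // -[|K] IH _; first by exists 0%N.
have [l /andP[h1 h2]] := IH isT.
have [e|ne] := eqVneq (2 ^ l)%N K.+1; first by exists l.+1; rewrite expnS; lia.
by exists l; lia.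
Qed.

Lemma pow_transfer (c M k s : nat) : (2 <= M)%N -> (1 <= c)%N ->
  (c * 2 ^ k <= 2 ^ s)%N -> (c * M ^ k <= M ^ s)%N.
Proof.
move=> M2 c1 h; have ks : (k <= s)%N.
  by rewrite -(@leq_exp2l 2)//; apply: leq_trans h; rewrite leq_pmull.
move: h; rewrite -(subnK ks) !expnD !leq_mul2r => /orP[|h].
  by rewrite expn_eq0.
apply/orP; right; apply: (leq_trans h).
by case: (s - k)%N => // d; rewrite leq_exp2r.
Qed.

Section ExactPairs.
Context {R : realType} {X : nat -> completeNormedModType R}.
Context {m n : nat -> nat} {F : forall k, set (X k -> R^o)}.
Context {sigma : seq (functional X) -> nat}.
Context {Z : completeNormedModType R} {iota : {linear Omega00 X -> Z}}.
Hypotheses (hmn : parameters m n) (hF : forall k, norming_set (@F k)).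
Hypothesis hZ : is_d_product m n F sigma iota.
Implicit Types (f g h : functional X) (fs gs : seq (functional X)) (x y : Omega00 X).
Implicit Type U : set (Omega00 X).

Notation L := (Lset m n F sigma).
Notation LZ := (withzero L).
Local Notation N x := `|iota x|.
Local Notation flat := (flat (m := m) (n := n) (F := F) (sigma := sigma)).

Let bLZ f : LZ f -> dual_ball00 f. Proof. exact: (LZ_ball hmn hF). Qed.

Lemma waverages_ball i h : (1 <= i)%N -> waverages m n i L h -> dual_ball00 h.
Proof.
move=> i1 [gs [_ s Lg ->]]; apply: dual_ball00_avg => // [|g /Lg/bLZ//].
have m1 : 1 <= (m i)%:R :> R by rewrite ler1n (leq_trans _ (m_ge2 hmn i1)).
by rewrite invr_ge0 ler0n invf_le1 ?(lt_le_trans ltr01).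
Qed.

(** A functional of weight m_i is uniformly small on a rapidly increasing sequence
    up to one term: the vectors with index above i are flat for n_i functionals,
    and those before the last one with index at most i are too short for 1/m_i. *)
Lemma ris_weight a (u : nat -> Omega00 X) (jx : nat -> nat) (B : nat) i h :
  (forall k, (a k < a k.+1)%N) -> blocks a u -> (forall k, flat (n (jx k).-1) 4 (u k)) ->
  (1 <= B)%N -> (forall k, (2 <= jx k)%N) -> (forall k, (4 * a k * B <= m (jx k))%N) ->
  (1 <= i)%N -> waverages m n i L h ->
  exists k0, forall k, k <> k0 -> `|eval00 h (u k)| <= 4 / (m i)%:R + B%:R^-1.
Proof.
move=> ainc bu fu B1 jx2 jxa i1 ah.
have ak k : (k <= a k)%N by elim: k => // k IH; apply: leq_ltn_trans (ainc k).
have m0 : 0 < (m i)%:R :> R by rewrite ltr0n; have := m_ge2 hmn i1; lia.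
have B0 : 0 < B%:R :> R by rewrite ltr0n.
(* the exception k0 is the last k with jx k <= i, or 0 if there is none *)
pose P := [pred k | `[< forall l, (k < l)%N -> (i < jx l)%N >]].
have exP : exists k, P k.
  exists (m i); apply/asboolP => l il; rewrite ltnNge; apply/negP => jl.
  have : (m (jx l) <= m i)%N by apply: (m_mono hmn); have := jx2 l; lia.
  by have := jxa l; have := ak l; nia.
case: (ex_minnP exP) => k0 /asboolP hk0 k0m; exists k0 => k kk0.
have [kl|kl] := ltnP k0 k.
  have ij := hk0 _ kl; have nij : (n i <= n (jx k).-1)%N by apply: (n_mono hmn); lia.
  rewrite (le_trans (waverages_flat i1 ah nij (fu k)))//.
  by rewrite mulrC lerDl invr_ge0 ltW.
have {kl} kk : (k < k0)%N by lia.
have jk0 : (jx k0 <= i)%N.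
  rewrite leqNgt; apply/negP => ij; have : P k.
    apply/asboolP => l kl; have [->//|lk0] := eqVneq l k0.
    have [|l0] := ltnP k0 l; first exact: hk0.
    have : P k0.-1 by apply/asboolP => l' ?; have [->//|?] := eqVneq l' k0; apply: hk0; lia.
    by move=> /k0m; lia.
  by move=> /k0m; lia.
have Nu : N (u k) <= 4.
  apply: (flat_norm hZ _ (fu k)).
  by have := jx2 k => ?; have := n_ge3 hmn (i := (jx k).-1); lia.
have wk : supp_in (a k) (a k.+1) (u k) by case: bu.
rewrite (le_trans (waverages_count hmn hF hZ ah wk))//.
apply: (@le_trans _ _ B%:R^-1); last by rewrite lerDr divr_ge0// ltW.
rewrite ler_pdivrMl// ler_pdivlMr//.
apply: (@le_trans _ _ ((a k.+1)%:R * 4 * B%:R)).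
  by rewrite ler_wpM2r// ler_wpM2l.
rewrite -!natrM ler_nat.
have : (m (jx k0) <= m i)%N by apply: (m_mono hmn); have := jx2 k0; lia.
have : (a k.+1 <= a k0)%N by apply: (blocks_mono bu).
by have := jxa k0; nia.
Qed.

(** Although f has weight j and takes the value 1 on z, functionals h of every other
    weight are small there: flatness gives 17/m_i if the weight i of h is less
    than j, and the last clause 9/m_j if it is larger. *)
Definition exact_pair j z f :=
  [/\ L f, Lweight m n F sigma j f, eval00 f z = 1, flat (n j.-1) 17 z &
    forall i h, (j < i)%N -> LZ h -> waverages m n i L h -> `|eval00 h z| <= 9 / (m j)%:R].

(** z is a multiple of the sum of a rapidly increasing sequence of n_j averages x_k,
    and f the average of functionals f_k with f_k(x_k) > 1. The vector is flat by
    [iterated_cut] with l rounds, where 2^l is of the order of m_j: the number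
    M^(l+1) of pieces is then still negligible against n_j = M^s. *)
Lemma exists_exact_pair U j p0 : rich U -> (2 <= j)%N -> ~~ odd j ->
  exists z f q, [/\ U z, exact_pair j z f, (p0 < q)%N, supp_in p0 q z & supp_in p0 q f].
Proof.
move=> rU j2 ej.
pose P (hist : seq (Omega00 X * functional X * nat)) p (t : Omega00 X * functional X * nat) q :=
  [/\ U t.1.1, L t.1.2 /\ t.1.2 <> 0, 1 < eval00 t.1.2 t.1.1,
    [/\ (p < q)%N, supp_in p q t.1.1 & supp_in p q t.1.2] &
    [/\ flat (n t.2.-1) 4 t.1.1, (j < t.2)%N & (4 * p * m j ^ 2 <= m t.2)%N]].
have [hist p|t [a [a0 ht]]] := @block_choice _ P p0.
  (* odd, larger than j, and with m_i >= 4 p m_j^2 because m_i >= 2^i *)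
  pose i := (j + 4 * p * m j ^ 2).*2.+1.
  have [||x [Ux px Nx fx]] := l1_average hmn hF hZ (U := U) (j := i) p rU.
  - by rewrite /i; lia.
  - by rewrite /i /= odd_double.
  have [|f [q [Lf f0 fx1 pq [w1 w2]]]] := norming_pair hmn hF hZ (r := 1) px.
    by rewrite ler01.
  exists (x, f, i), q; split=> //; split=> //=; first by rewrite /i; lia.
  rewrite (leq_trans _ (m_exp hmn _))// (leq_trans _ (ltnW (ltn_expl _ _)))//.
  by rewrite /i; lia.
pose x k := (t k).1.1; pose f k := (t k).1.2; pose jx k := (t k).2.
have ainc k : (a k < a k.+1)%N by have [_ _ _ [? _ _] _] := ht k.
have bx : blocks a x by split=> k; [exact: ltnW|have [_ _ _ [_ ? _] _] := ht k].
have bf : blocks a f by split=> k; [exact: ltnW|have [_ _ _ [_ _ ?] _] := ht k].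
have Ux k : U (x k) by case: (ht k).
have Lf k : L (f k) by case: (ht k) => _ [].
have f0 k : f k <> 0 by case: (ht k) => _ [].
have fx k : 1 < eval00 (f k) (x k) by case: (ht k).
have flx k : flat (n (jx k).-1) 4 (x k) by case: (ht k) => _ _ _ _ [].
have jxj k : (j < jx k)%N by case: (ht k) => _ _ _ _ [].
have jxa k : (4 * a k * m j ^ 2 <= m (jx k))%N by case: (ht k) => _ _ _ _ [].
clearbody x f jx; clear t P ht.
have j1 : (1 <= j)%N by lia.
have jm1 : (1 <= j.-1)%N by lia.
have [s [nj ms]] := n_step hmn jm1; rewrite prednK// in nj ms.
pose M := n j.-1; pose K := n j; have KE : K = (M ^ s)%N by exact: nj.
have M3 : (3 <= M)%N by exact: n_ge3 hmn _ jm1.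
have m4 : (4 <= m j)%N.
  apply: leq_trans (m_exp hmn j1); apply: (@leq_trans (2 ^ 2)%N) => //.
  by rewrite leq_exp2l.
have mj0 : (0 < m j)%N by apply: leq_trans m4.
have [l /andP[l1 l2]] := pow2_between mj0.
have small : (m j * M ^ l.+1 <= K)%N.
  rewrite KE; apply: pow_transfer; [lia|lia|].
  by apply: leq_trans (ltnW ms); rewrite !expnS expn0; nia.
have mK : (m j ^ 2 <= K)%N.
  rewrite KE; apply: (@leq_trans (2 ^ s)%N).
    by apply: leq_trans (ltnW ms); rewrite leq_exp2l//; lia.
  case: s nj KE ms => // s _ _; by rewrite leq_exp2r//; lia.
have m0 : 0 < (m j)%:R :> R by rewrite ltr0n; lia.
have K0 : 0 < K%:R :> R by rewrite ltr0n; have := n_ge3 hmn j1; rewrite /K; lia.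
have jx2 k : (2 <= jx k)%N by have := jxj k; lia.
have Nx k : N (x k) <= 4.
  apply: (flat_norm hZ _ (flx k)).
  by have := jx2 k => ?; have := n_ge3 hmn (i := (jx k).-1); lia.
have weight i h : (j <= i)%N -> LZ h -> waverages m n i L h -> forall i' b, (i' <= b)%N ->
    `|eval00 h (\sum_(i' <= k < b) x k)| <=
    (4 / (m i)%:R + (m j ^ 2)%:R^-1) * (b - i')%:R + 4.
  move=> ji Lh ah i' b ib; have i1 : (1 <= i)%N by lia.
  have mB : (1 <= m j ^ 2)%N by rewrite expn_gt0; lia.
  have [k0 hk0] := ris_weight ainc bx flx mB jx2 jxa i1 ah.
  rewrite (eval_sumr _ _ (waverages_ball i1 ah)).
  apply: (sum_one_exception (k0 := k0)) => //.
  by move=> k; rewrite (le_trans (eval_le hF hZ _ Lh)).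
have mi i : (j <= i)%N -> 4 / (m i)%:R <= 4 / (m j)%:R :> R.
  move=> ji; have := m_mono hmn (i := j) (j := i); rewrite j1 ji => /(_ isT) mm.
  by rewrite ler_pM2l// lef_pV2 ?posrE ?ltr0n ?ler_nat//; lia.
pose d : R := 4 / (m j)%:R + (m j ^ 2)%:R^-1.
have d0 : 0 <= d by rewrite addr_ge0// ?divr_ge0// invr_ge0.
have flM k : flat M 4 (x k).
  by apply: flat_sub (flx k) => //; apply: (n_mono hmn); have := jxj k; lia.
have cut g i b : LZ g -> (i <= b)%N -> `|eval00 g (\sum_(i <= k < b) x k)| <=
    (4 / 2 ^+ l + d) * (b - i)%:R + 4 * M%:R ^+ l.
  have M1 : (1 <= M)%N by lia.
  have C4 : 0 <= (4 : R) <= 4 by apply/andP; split; lra.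
  apply: (iterated_cut hmn hF (j0 := j) bx flM M1 C4 d0).
    by move=> i' /andP[i1 ij]; apply: (n_mono hmn); lia.
  move=> h Lh; case: (L_cases Lh) => [Fh|[i' [i1 /(Lweight_waverages hF) ah]]]; first by constructor 1.
  have [ij|ji] := ltnP i' j; first by constructor 2; exists i'; rewrite i1.
  constructor 3 => c e ce; rewrite (le_trans (weight _ _ ji (or_introl Lh) ah _ _ ce))//.
  by rewrite lerD2r ler_wpM2r// lerD2r mi.
have fl0 : flat M ((K%:R / (m j)%:R) * 17) (\sum_(0 <= k < K) x k).
  move=> gs sgs lg; have A0 : 0 <= 4 / 2 ^+ l + d by rewrite addr_ge0// divr_ge0// exprn_ge0.
  have B0 : 0 <= 4 * M%:R ^+ l :> R by rewrite mulr_ge0// exprn_ge0.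
  have hg g i b : g \in gs -> (i <= b)%N -> `|eval00 g (\sum_(i <= k < b) x k)| <=
    (4 / 2 ^+ l + d) * (b - i)%:R + 4 * M%:R ^+ l.
    by move=> gg; apply: cut; case: lg => _; exact.
  have := evals_blocks hmn hF bx flM A0 B0 (ler0n R 4) sgs lg hg (leq0n K).
  move=> h1; apply: (le_trans h1); rewrite subn0.
  have h2 : (size gs)%:R * (4 * M%:R ^+ l + 4) <= M%:R * (4 * M%:R ^+ l + 4) :> R.
    by rewrite ler_wpM2r ?ler_nat// addr_ge0.
  have h3 : M%:R * (4 * M%:R ^+ l + 4) <= 8 * (K%:R / (m j)%:R) :> R.
    rewrite mulrA ler_pdivlMr//.
    have : (m j)%:R * M%:R ^+ l.+1 <= K%:R :> R by rewrite -natrX -natrM ler_nat.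
    have : 1 <= M%:R ^+ l :> R by rewrite exprn_ege1// ler1n (leq_trans _ M3).
    rewrite exprS => q1 q2.
    have : (m j)%:R * M%:R * 1 <= (m j)%:R * M%:R * M%:R ^+ l :> R.
      by rewrite ler_wpM2l// mulr_ge0.
    lra.
  have h4 : (4 / 2 ^+ l + d) * K%:R <= 9 * (K%:R / (m j)%:R).
    rewrite (_ : 9 * _ = 9 / (m j)%:R * K%:R); last lra.
    rewrite ler_pM2r// /d.
    have : 4 / 2 ^+ l <= 4 / (m j)%:R :> R.
      by rewrite ler_pM2l// lef_pV2 ?posrE ?exprn_gt0// -natrX ler_nat.
    have : (m j ^ 2)%:R^-1 <= (m j)%:R^-1 :> R.
      by rewrite lef_pV2 ?posrE ?ltr0n ?expn_gt0 ?mj0// ler_nat -{1}[m j]expn1 leq_pexp2l.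
    lra.
  lra.
have Kj : (m j)%:R / K%:R * (K%:R / (m j)%:R) = 1 :> R.
  by rewrite mulrA divfK ?gt_eqF// divff// gt_eqF.
pose f1 := (m j)%:R^-1 *: \sum_(g <- mkseq f K) g.
pose z0 := ((m j)%:R / K%:R) *: \sum_(0 <= k < K) x k.
have Lof1 : Lweight m n F sigma j f1 by exact: (pair_functional hmn Lf f0 bf j1 ej).
have Lf1 := Lweight_L Lof1.
have f1z : 1 <= eval00 f1 z0.
  rewrite /z0 evalZr; last by apply: bLZ; left.
  rewrite (pair_eval hmn hF _ _ Lf bf bx) -[leLHS]Kj ler_wpM2l ?divr_ge0//.
  rewrite mulrC ler_wpM2l ?invr_ge0// -[leLHS]mulr1 mulr_natl -[X in _ *+ X](subn0 K).
  by rewrite -sumr_const_nat ler_sum_nat// => k _; exact: ltW.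
have c0 : 0 < eval00 f1 z0 by lra.
have ci : 0 <= (eval00 f1 z0)^-1 <= 1 by rewrite invr_ge0 ltW//= invf_le1.
have nci : `|(eval00 f1 z0)^-1| <= 1 by case/andP: ci => c1 c2; rewrite ger0_norm.
exists ((eval00 f1 z0)^-1 *: z0), f1, (a K); split.
- by apply: richZ => //; apply: richZ => //; exact: rich_sum.
- split=> //.
  + by rewrite evalZr ?mulVf ?gt_eqF//; apply: bLZ; left.
  + apply: flat_sub (flat_scale hmn hF _ (flat_scale hmn hF ((m j)%:R / K%:R) fl0)) => //.
    rewrite [`|(m j)%:R / _|]ger0_norm ?divr_ge0//.
    have -> : (m j)%:R / K%:R * (K%:R / (m j)%:R * 17) = 17 :> R.
      by rewrite [LHS]mulrA Kj mul1r.
    by rewrite -[leRHS]mul1r ler_wpM2r.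
  + move=> i h ji Lh ah; have bh := bLZ Lh.
    rewrite !(evalZr _ _ bh) !normrM [`|(m j)%:R|]ger0_norm// [`|K%:R^-1|]ger0_norm ?invr_ge0//.
    rewrite -[leRHS]mul1r ler_pM// ?mulr_ge0// ?invr_ge0//.
    have := weight _ _ (ltnW ji) Lh ah 0%N K isT; rewrite subn0 => w.
    have q1 : 4 / (m i)%:R <= 4 / (m j ^ 2)%:R :> R.
      have mm : (m j ^ 2 <= m i)%N.
        apply: (@leq_trans (m j.+1)); last exact: (m_mono hmn).
        by apply: leq_trans (mS5 hmn j1); rewrite leq_pexp2l.
      by rewrite ler_pM2l// lef_pV2 ?posrE ?ltr0n ?expn_gt0 ?mj0 ?ler_nat// (leq_trans _ mm)// expn_gt0 mj0.
    have q2 : 4 <= 4 / (m j ^ 2)%:R * K%:R :> R.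
      by rewrite mulrAC ler_pdivlMr ?ltr0n ?expn_gt0 ?(leq_trans _ m4)// ler_pM2l// ler_nat.
    rewrite (@le_trans _ _ ((m j)%:R / K%:R * ((9 / (m j ^ 2)%:R) * K%:R)))//.
      rewrite ler_wpM2l ?divr_ge0// (le_trans w)//.
      have : 4 / (m i)%:R * K%:R <= 4 / (m j ^ 2)%:R * K%:R :> R by rewrite ler_wpM2r.
      by rewrite mulrDl; lra.
    rewrite mulrA [_ / K%:R * _]mulrAC divfK ?gt_eqF//.
    have e : (m j)%:R * (m j ^ 2)%:R^-1 = (m j)%:R^-1 :> R.
      by rewrite natrX expr2 invfM mulrA mulfV ?gt_eqF// mul1r.
    lra.
- rewrite -a0 (leq_trans (ainc 0%N))// (blocks_mono bx)//.
  exact: leq_trans (n_ge3 hmn j1).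
- by rewrite -a0; apply/supp_inZ/supp_inZ/blocks_sum.
- rewrite -a0; apply: supp_inZ; apply: supp_in_sum => _ /mapP[k + ->].
  rewrite mem_iota => /andP[_ kK]; case: (bf) => _ /(_ k); apply: supp_in_sub.
    exact: (blocks_mono bf).
  by apply: (blocks_mono bf); move: kK; rewrite add0n.
Qed.

End ExactPairs.

(** * Dependent sequences *)

Lemma alternating_sum (R : realType) (c e i b : nat) : (i <= b)%N ->
  `|\sum_(i <= k < b) (-1) ^+ k * (c <= k < e)%N%:R| <= 1 :> R.
Proof.
(* (-1)^k is the increment of k |-> -(-1)^k/2; clamping k freezes this function
   outside [c, e) *)
move=> ib; pose cl k := minn (maxn k c) (maxn c e).
pose u k : R := - (-1) ^+ cl k / 2.
have u2 k : `|u k| <= 2^-1.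
  by rewrite /u normrM normrN normrX normrN1 expr1n mul1r ger0_norm.
have -> : \sum_(i <= k < b) (-1) ^+ k * (c <= k < e)%N%:R = u b - u i :> R.
  rewrite -telescope_sumr//; apply: eq_bigr => k _; rewrite /u.
  have [/andP[ck ke]|h] := boolP (c <= k < e)%N.
    have cl1 : cl k = k by rewrite /cl; clear -ck ke; lia.
    have cl2 : cl k.+1 = k.+1 by rewrite /cl; clear -ck ke; lia.
    by rewrite cl1 cl2 exprS mulr1; clear; lra.
  have -> : cl k.+1 = cl k by rewrite /cl; clear -h; lia.
  by rewrite mulr0 subrr.
by rewrite (le_trans (ler_normB _ _))//; move: (u2 b) (u2 i); clear; lra.
Qed.

Section Dependent.
Context {R : realType} {X : nat -> completeNormedModType R}.
Context {m n : nat -> nat} {F : forall k, set (X k -> R^o)}.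
Context {sigma : seq (functional X) -> nat}.
Context {Z : completeNormedModType R} {iota : {linear Omega00 X -> Z}}.
Hypotheses (hmn : parameters m n) (hF : forall k, norming_set (@F k)).
Hypothesis hsigma : coding m n F sigma.
Hypothesis hZ : is_d_product m n F sigma iota.
Implicit Types (g h : functional X) (fs gs : seq (functional X)) (x y : Omega00 X).
Implicit Type U : set (Omega00 X).

Notation L := (Lset m n F sigma).
Notation LZ := (withzero L).
Local Notation N x := `|iota x|.
Local Notation flat := (flat (m := m) (n := n) (F := F) (sigma := sigma)).
Local Notation Lweight := (Lweight m n F sigma).
Local Notation exact_pair := (exact_pair (m := m) (n := n) (F := F) (sigma := sigma)).

Let bLZ f : LZ f -> dual_ball00 f. Proof. exact: (LZ_ball hmn hF). Qed.

(** These sequences are infinite, although only n_j terms are summed in the end, to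
    spare the estimates a bound on k. The first index 2 (n_j + 1) is the least one
    that special sequences of weight j admit. *)
Definition dependent j a z (f : nat -> functional X) (v : nat -> nat) :=
  [/\ (forall k, (a k < a k.+1)%N), blocks a z, blocks a f,
      (forall k, exact_pair (v k) (z k) (f k)) &
   [/\ v 0%N = (n j).+1.*2, (forall k, (v k < v k.+1)%N),
      forall k, (0 < k)%N -> v k = sigma (mkseq f k) &
      forall k, (0 < k)%N -> Kseq m n F (mkseq f k)]].

Lemma exact_nz j z f : exact_pair j z f -> f <> 0.
Proof. by case=> _ _ e _ _ f0; move: e; rewrite f0 eval0l => /esym/eqP; rewrite oner_eq0. Qed.

(** The choice is greedy. The induction shows that at each step the functionals chosen
    so far form a sequence of K, so that its code is an even index, larger than
    the indices before it. *)
Lemma exists_dependent (U : nat -> set (Omega00 X)) j : (forall k, rich (U k)) ->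
  exists a z f v, dependent j a z f v /\ forall k, U k (z k).
Proof.
move=> rU; pose idx (hist : seq (Omega00 X * functional X)) :=
  if hist is [::] then (n j).+1.*2 else sigma (map snd hist).
pose good i := (2 <= i)%N && ~~ odd i.
pose P (hist : seq (Omega00 X * functional X)) p (zf : Omega00 X * functional X) q :=
  [/\ (p < q)%N, supp_in p q zf.1, supp_in p q zf.2 &
    good (idx hist) -> exact_pair (idx hist) zf.1 zf.2 /\ U (size hist) zf.1].
have [hist p|zf [a [_ hzf]]] := @block_choice _ P 0%N.
  have [/andP[i2 ie]|ng] := boolP (good (idx hist)).
    have [z [f [q [Uz e pq w1 w2]]]] := exists_exact_pair hmn hF hZ p (rU (size hist)) i2 ie.
    by exists (z, f), q.
  by exists (0, 0), p.+1; split=> // gg; rewrite gg in ng.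
pose z k := (zf k).1; pose f k := (zf k).2; pose v k := idx (mkseq zf k).
have vS k : (0 < k)%N -> v k = sigma (mkseq f k).
  by case: k => // k _; rewrite /v /mkseq /= -map_comp.
have ainc k : (a k < a k.+1)%N by case: (hzf k).
have bz : blocks a z by split=> k; [exact: ltnW|case: (hzf k)].
have bf : blocks a f by split=> k; [exact: ltnW|case: (hzf k)].
have hg k : good (v k) -> exact_pair (v k) (z k) (f k) /\ U k (z k).
  by case: (hzf k) => _ _ _ h /h; rewrite size_mkseq.
have Ks k : (0 < k)%N -> (forall i, (i < k)%N -> good (v i)) -> Kseq m n F (mkseq f k).
  move=> k0 h; have nz i : (i < k)%N -> f i <> 0 by move=> /h/hg[/exact_nz].
  split.
  - by move=> /(congr1 size); rewrite size_mkseq => kz; rewrite kz in k0.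
  - exact: blocks_successive bf nz.
  - move=> _ /mapP[i + ->]; rewrite mem_iota => /andP[_ ik].
    have Li : L (f i) by case: (hg _ (h _ ik)) => -[].
    exact: (L_K hF Li (nz _ ik)).
case: hsigma => seven _ sj smono.
have step k : (forall i, (i <= k)%N -> good (v i)) -> (v k < v k.+1)%N /\ good (v k.+1).
  move=> h; have [e _] := hg _ (h k (leqnn k)).
  have vk : (v k < v k.+1)%N.
    have [_ Lk _ _ _] := e; have fk := exact_nz e; rewrite (vS k.+1)//.
    case: k h e Lk fk => [|k] h e Lk fk.
      have L0 : L (f 0%N) by case: e.
      have A0 : Astar m n F (v 0%N) (f 0%N) by exact: (Lweight_Astar hF _ Lk fk).
      exact: leq_ltn_trans (jmax_ge hmn hF fk A0) (sj _ (L_K hF L0 fk) fk).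
    rewrite (vS k.+1)// [mkseq f k.+2]mkseqS; apply: smono.
      by move=> /(congr1 size); rewrite size_mkseq.
    by rewrite -mkseqS; apply: Ks => // i ik; apply: h.
  split=> //; apply/andP; split.
    by have /andP[h2 _] := h k (leqnn k); lia.
  have := seven (mkseq f k.+1) (Ks k.+1 isT h); rewrite -vS// => -[i [_ ->]].
  by rewrite mul2n odd_double.
have all_good k : forall i, (i <= k)%N -> good (v i).
  elim: k => [|k IH] i.
    by rewrite leqn0 => /eqP ->; rewrite /good /v /= odd_double.
  rewrite leq_eqVlt => /orP[/eqP->|]; last exact: IH.
  by case: (step k IH).
exists a, z, f, v; split; last by move=> k; case: (hg k (all_good k k (leqnn k))).
split=> //; first by move=> k; case: (hg k (all_good k k (leqnn k))).
split=> // [k|k k0]; first by case: (step k (all_good k)).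
by apply: Ks => // i _; exact: all_good (leqnn i).
Qed.

Lemma dependent_mono j a z f v k l : dependent j a z f v -> (k < l)%N -> (v k < v l)%N.
Proof.
case=> _ _ _ _ [_ vinc _ _]; elim: l => // l IH; rewrite ltnS leq_eqVlt => /orP[/eqP ->//|kl].
exact: ltn_trans (IH kl) (vinc l).
Qed.

Lemma dependent_ge j a z f v k : dependent j a z f v -> ((n j).+1.*2 <= v k)%N.
Proof.
move=> h; have v0 : v 0%N = (n j).+1.*2 by case: h => _ _ _ _ [].
by case: k => [|k]; rewrite -v0// ltnW// (dependent_mono h).
Qed.

Lemma take_mkseq (T : Type) (f : nat -> T) l K : (l <= K)%N -> take l (mkseq f K) = mkseq f l.
Proof. by move=> lK; rewrite /mkseq -map_take take_iota (minn_idPl lK). Qed.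

(** The functional built on the first n_j functionals of a dependent sequence
    belongs to L, whence a lower estimate for the sum of the vectors. *)
Lemma dependent_norm j a z f v : odd j -> dependent j a z f v ->
  (n j)%:R / (m j)%:R <= N (\sum_(0 <= k < n j) z k).
Proof.
move=> oj h; have [ainc bz bf ex [v0 vinc vS vK]] := h.
have nj : (3 <= n j)%N by apply: (n_ge3 hmn); case: j oj {h v0}.
have Lf k : L (f k) by case: (ex k).
have L1 : L ((m j)%:R^-1 *: \sum_(g <- mkseq f (n j)) g).
  apply: Lweight_L; apply: (L_odd_avg oj); exists (mkseq f (n j)) => //; split.
  - by rewrite size_mkseq leqnn andbT; lia.
  - by apply: (blocks_successive bf) => k _; exact: exact_nz (ex k).
  - split; first by move=> _ /mapP[k _ ->].
    split.
      exists (n j).+1; split=> //; rewrite nth_mkseq; last lia.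
      by rewrite mul2n -v0; case: (ex 0%N).
    move=> l; rewrite size_mkseq => /andP[l0 ln].
    by rewrite take_mkseq ?(ltnW ln)// nth_mkseq// -vS//; case: (ex l).
have := eval_le hF hZ (\sum_(0 <= k < n j) z k) (or_introl L1).
rewrite (pair_eval hmn hF _ _ Lf bf bz) => /(le_trans (ler_norm _)); apply: le_trans.
rewrite mulrC ler_wpM2l ?invr_ge0// (eq_bigr (fun=> 1)); last by move=> k _; case: (ex k).
by rewrite sumr_const_nat subn0 ler_wMn2r// lexx.
Qed.

End Dependent.

(** * Special functionals and the core of the argument *)

Section Core.
Context {R : realType} {X : nat -> completeNormedModType R}.
Context {m n : nat -> nat} {F : forall k, set (X k -> R^o)}.
Context {sigma : seq (functional X) -> nat}.
Context {Z : completeNormedModType R} {iota : {linear Omega00 X -> Z}}.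
Hypotheses (hmn : parameters m n) (hF : forall k, norming_set (@F k)).
Hypothesis hsigma : coding m n F sigma.
Hypothesis hZ : is_d_product m n F sigma iota.
Implicit Types (g h : functional X) (fs gs : seq (functional X)) (x y : Omega00 X).
Implicit Type U : set (Omega00 X).

Notation L := (Lset m n F sigma).
Notation LZ := (withzero L).
Local Notation N x := `|iota x|.
Local Notation flat := (flat (m := m) (n := n) (F := F) (sigma := sigma)).
Local Notation Lweight := (Lweight m n F sigma).
Local Notation exact_pair := (exact_pair (m := m) (n := n) (F := F) (sigma := sigma)).
Local Notation dependent := (dependent (m := m) (n := n) (F := F) (sigma := sigma)).

Let bLZ f : LZ f -> dual_ball00 f. Proof. exact: (LZ_ball hmn hF). Qed.

Lemma minv_le i i' : (1 <= i' <= i)%N -> (m i)%:R^-1 <= (m i')%:R^-1 :> R.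
Proof.
move=> /andP[i1 ii]; have h := m_ge2 hmn i1; have h' : (m i' <= m i)%N by rewrite (m_mono hmn)// i1.
have p' : (0 < m i')%N by apply: leq_trans h.
by rewrite lef_pV2 ?posrE ?ltr0n ?ler_nat// (leq_trans p').
Qed.

(** The action of a functional on an exact pair of a different index: flatness
    handles the smaller weights, the last clause of exactness the larger ones. *)
Lemma exact_pair_eval j z f i q h : exact_pair j z f -> (1 <= q <= i)%N -> (q <= j)%N ->
  i <> j -> LZ h -> waverages m n i L h -> `|eval00 h z| <= 26 / (m q)%:R.
Proof.
move=> [_ _ _ fl tl] qi qj ij Lh ah; have /andP[q1 q2] := qi.
have mq0 : 0 <= (m q)%:R^-1 :> R by rewrite invr_ge0.
have [lt|gt|//] := ltngtP i j.
  have i1 : (1 <= i)%N := leq_trans q1 q2.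
  have nij : (n i <= n j.-1)%N by apply: (n_mono hmn); rewrite i1 /=; case: j lt {ij fl tl qj}.
  rewrite (le_trans (waverages_flat i1 ah nij fl))//.
  have := minv_le qi; have : 0 <= (m i)%:R^-1 :> R by rewrite invr_ge0.
  lra.
rewrite (le_trans (tl _ _ gt Lh ah))//.
have : (m j)%:R^-1 <= (m q)%:R^-1 :> R by rewrite minv_le// q1.
by move: mq0; lra.
Qed.

Lemma exact_pair_norm j z f : (2 <= j)%N -> exact_pair j z f -> N z <= 17.
Proof.
move=> j2 [_ _ _ fl _]; apply: (flat_norm hZ _ fl).
by apply: (@leq_trans 3) => //; apply: (n_ge3 hmn); case: j j2 {fl} => [|[]].
Qed.

Lemma n_m_bound j : (1 <= j)%N ->
  (n j)%:R / (m (n j).+1.*2)%:R <= (n j)%:R^-1 :> R.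
Proof.
move=> j1; have n3 := n_ge3 hmn j1; have n0 : (0 < n j)%N by apply: leq_trans n3.
have q1 : (1 <= (n j).+1.*2)%N by [].
have h : (n j * n j <= m (n j).+1.*2)%N.
  apply: leq_trans (m_exp hmn q1); rewrite -muln2 expnM mulnn leq_exp2r//.
  exact: leq_trans (leqnSn _) (ltnW (ltn_expl _ _)).
have m0 : (0 < m (n j).+1.*2)%N by apply: leq_trans h; rewrite muln_gt0 n0.
by rewrite ler_pdivrMr ?ltr0n// ler_pdivlMl ?ltr0n// -natrM ler_nat.
Qed.

(** Incomparability of special sequences: let g be of weight j, built on the
    special sequence gs. As long as gs follows the dependent sequence, g takes the
    same value on each z_k; after they part, all the weights in gs differ from the
    indices of the z_k, by injectivity of the coding, and g is small on z_k. This
    leaves out at most five k: the first one, the two around the place where gs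
    departs from the dependent sequence, the one whose index is the weight of
    the first term of gs, and the one where the tail cuts. *)
Lemma special_values j a z f v g : odd j -> dependent j a z f v -> Lweight j g ->
  exists (s : R) (c e : nat) (E : seq nat), [/\ `|s| <= 1, (size E <= 5)%N &
    forall k, k \notin E ->
      `|eval00 g (z k) - s * (c <= k < e)%N%:R| <= 26 / (n j)%:R].
Proof.
move=> oj dep Lg; have j1 : (1 <= j)%N by case: j oj {dep Lg}.
have [ainc bz bf ex [v0 vinc vS vK]] := dep.
have [b [p [gs [sz su Lgs sp gE]]]] := Lweight_oddP oj Lg.
(* t0 is the length of the initial segment that gs has in common with f *)
pose P := [pred r | (size gs <= r)%N || (nth 0 gs r != f r)].
have exP : exists r, P r by exists (size gs); rewrite /= leqnn.
case: (ex_minnP exP) => t0 Pt0 tmin.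
have t0s : (t0 <= size gs)%N by apply: tmin; rewrite /= leqnn.
have common r : (r < t0)%N -> nth 0 gs r = f r.
  move=> rt; apply/eqP; apply: contraTT rt => h.
  by rewrite -leqNgt tmin//= h orbT.
have ak k : (k <= a k)%N by elim: k => // k IH; apply: leq_ltn_trans (ainc k).
(* c is the first window that starts after the cut p *)
have exc : exists k, (p <= a k)%N by exists p; exact: ak.
case: (ex_minnP exc) => c pc cmin.
have vinj k l : v k = v l -> k = l.
  by move=> vkl; have [/(dependent_mono dep)|/(dependent_mono dep)|//] := ltngtP k l;
    rewrite vkl ltnn.
(* the weight of the first term of gs is not a code: it may be the index of one z_k *)
have [k1 hk1] : exists k1, forall k, k <> k1 -> (0 < size gs)%N ->
    exists w, [/\ ((n j).+1.*2 <= w)%N, Lweight w (nth 0 gs 0) & w <> v k].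
  have [gs0|gs0] := posnP (size gs); first by exists 0%N.
  have [w [w1 w2 _]] := special_weights hmn hF hsigma su Lgs sp gs0.
  case: (pselect (exists k, w = v k)) => [[k1 wk1]|nk].
    by exists k1 => k kk1 _; exists w; split=> //; rewrite wk1 => /vinj /esym.
  by exists 0%N => k _ _; exists w; split=> // wk; apply: nk; exists k.
pose E := [:: 0; t0.-1; t0; k1; c.-1]%N.
have weights r k : k \notin E -> (t0 < k)%N -> (t0 <= r < size gs)%N ->
    exists w, [/\ ((n j).+1.*2 <= w)%N, Lweight w (nth 0 gs r) & w <> v k].
  rewrite !inE !negb_or => /and5P[k0 _ _ /eqP kk1 _] tk /andP[tr rs].
  have [r0|r0] := posnP r; first by rewrite r0 in rs *; exact: hk1.
  have [w [w1 w2 w3]] := special_weights hmn hF hsigma su Lgs sp rs.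
  exists w; split=> //; rewrite (w3 r0) vS ?lt0n// => e.
  have Kr : Kseq m n F (take r gs) by apply: (take_Kseq hF su Lgs); rewrite r0 ltnW.
  case: hsigma => _ sinj _ _; have := sinj _ _ Kr (vK k (leq_ltn_trans (leq0n _) tk)) e => te.
  have rk : r = k by have := congr1 size te; rewrite size_mkseq size_takel// ltnW.
  move: Pt0; rewrite /= leqNgt (leq_ltn_trans tr rs) /= => /eqP; apply.
  have := congr1 (fun s => nth 0 s t0) te; rewrite /= nth_mkseq// nth_take//.
  by rewrite rk.
have ballgs r : (r < size gs)%N -> dual_ball00 (nth 0 gs r).
  by move=> rs; apply: bLZ; left; apply: Lgs; apply: mem_nth.
have geval k : eval00 g (z k) = (-1) ^+ b / (m j)%:R *
    \sum_(0 <= r < size gs) eval00 (tail p (nth 0 gs r)) (z k).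
  rewrite gE tailZ tail_sum !evalZl mulrA; congr (_ * _).
  by rewrite -(big_map (tail p) xpredT id) eval_suml big_map (big_nth 0).
exists ((-1) ^+ b / (m j)%:R), c, t0.-1, E; split=> //.
  rewrite normrM normrX normrN1 expr1n mul1r ger0_norm ?invr_ge0//.
  have m2 := m_ge2 hmn j1.
  by rewrite invf_le1 ?ler1n ?ltr0n (leq_trans _ m2).
move=> k kE; have := kE; rewrite !inE !negb_or => /and5P[k0 kt1 kt _ kc].
have nj0 : 0 <= 26 / (n j)%:R :> R by rewrite divr_ge0.
have disj r : (r < t0)%N -> r <> k -> eval00 (tail p (nth 0 gs r)) (z k) = 0.
  move=> rt rk; rewrite (common _ rt); apply: eval_disj.
    by apply: dual_ball00_tail; rewrite -(common _ rt); apply: ballgs; exact: leq_trans t0s.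
  move=> l; have [fl|/eqP fl] := eqVneq (f r l) 0; first by left; rewrite tailE fl if_same.
  by right; apply: contrapT => zl; apply: rk; exact: (blocks_index bf bz fl zl).
rewrite geval; have [kt0|tk] := ltnP k t0.-1.
  have kt0' : (k < t0)%N by apply: leq_trans kt0 (leq_pred _).
  rewrite -mulrBr (_ : _ - _ = 0) ?mulr0 ?normr0//; apply/eqP; rewrite subr_eq0; apply/eqP.
  have ki : k \in index_iota 0 (size gs) by rewrite mem_index_iota (leq_trans kt0').
  rewrite andbT (bigD1_seq k ki) ?iota_uniq//= [X in _ + X]big1_seq ?addr0; last first.
    move=> r /andP[/eqP rk]; rewrite mem_index_iota => /andP[_ rs].
    have [rt|tr] := ltnP r t0; first exact: disj.
    rewrite eval_tail; last exact: ballgs.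
    have wz : supp_in (a k) (a k.+1) (tail p (z k)) by apply: supp_in_tail; case: bz.
    apply: (eval_before (ballgs _ rs) wz) => l lk; apply: contrapT => hl.
    have [l0 /eqP fl0] := nz_supp (exact_nz (ex t0.-1)).
    have t0p : (t0.-1 < t0)%N by rewrite prednK// (leq_ltn_trans _ kt0').
    have gl0 : nth 0 gs t0.-1 l0 <> 0 by rewrite common.
    have lt : supp_lt (nth 0 gs t0.-1) (nth 0 gs r).
      by apply: (wsuccessive_lt (successiveW su)); rewrite (leq_trans t0p)//.
    have := (supp_ltP _ _).1 lt _ _ gl0 hl.
    have /andP[al _] := blocks_support bf fl0.
    by rewrite ltnNge (leq_trans _ (leq_trans (blocks_mono bf kt0) al))// ltnW.
  rewrite common// eval_tail; last by rewrite -common//; apply: ballgs; exact: leq_trans t0s.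
  have [ck|kc'] := leqP c k.
    rewrite tail_id; first by case: (ex k).
    move=> l lp; case: bz => _ /(_ k); apply; apply/orP; left.
    exact: leq_trans lp (leq_trans pc (blocks_mono bf ck)).
  have kc1 : (k.+1 <= c.-1)%N.
    by rewrite ltn_neqAle kc; case: (c) kc'.
  have c0 : (0 < c)%N by apply: leq_ltn_trans kc'.
  have pa : (a c.-1 <= p)%N.
    by rewrite ltnW// ltnNge; apply/negP => /cmin; rewrite leqNgt prednK// leqnn.
  case: bz => _ /(_ k) wz; rewrite (tailE0 wz) ?eval0r//.
    by rewrite -common//; apply: ballgs; exact: leq_trans t0s.
  exact: leq_trans (blocks_mono bf kc1) pa.
have tk' : (t0 < k)%N.
  by move: kt1 kt tk; clear; case: t0 => [|t0] /=; lia.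
rewrite andbF mulr0 subr0 normrM.
have m1 : `|(-1) ^+ b / (m j)%:R| <= 1 :> R.
  rewrite normrM normrX normrN1 expr1n mul1r ger0_norm ?invr_ge0//.
  have m2 := m_ge2 hmn j1.
  by rewrite invf_le1 ?ler1n ?ltr0n (leq_trans _ m2).
rewrite -[leRHS]mul1r ler_pM// (le_trans (ler_norm_sum _ _ _))//.
have q0 : 0 <= 26 / (m (n j).+1.*2)%:R :> R by rewrite divr_ge0.
apply: (@le_trans _ _ (\sum_(0 <= r < size gs) 26 / (m (n j).+1.*2)%:R)).
  apply: ler_sum_nat => r /= rs; have [rt|tr] := ltnP r t0.
    by rewrite disj ?normr0// => rk; move: rt; rewrite rk ltnNge ltnW.
  have [w [w1 w2 w3]] := weights r k kE tk' (introT andP (conj tr rs)).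
  apply: (exact_pair_eval (ex k)) w3 _ _.
  - by rewrite w1.
  - exact: dependent_ge dep.
  - by apply: (LZ_tail hF); left; exact: Lweight_L w2.
  - by apply: (waverages_tail _ (Lweight_waverages hF w2)) => h; exact: (L_tail hF).
rewrite sumr_const_nat subn0 -[leLHS]mulr_natr.
apply: (@le_trans _ _ (26 / (m (n j).+1.*2)%:R * (n j)%:R)); first by rewrite ler_wpM2l ?ler_nat.
by rewrite -!mulrA ler_wpM2l// mulrC n_m_bound.
Qed.

Lemma special_sum j a z f v g i b : odd j -> dependent j a z f v -> Lweight j g -> (i <= b)%N ->
  `|eval00 g (\sum_(i <= k < b) (-1) ^+ k *: z k)| <= 26 / (n j)%:R * (b - i)%:R + 91.
Proof.
move=> oj dep Lg ib; have [s [c [e [E [s1 E5 hE]]]]] := special_values oj dep Lg.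
have bg : dual_ball00 g by apply: bLZ; left; exact: Lweight_L Lg.
have Ng k : `|eval00 g (z k)| <= 17.
  have Lg' : LZ g by left; exact: Lweight_L Lg.
  rewrite (le_trans (eval_le hF hZ _ Lg'))//.
  case: (dep) => _ _ _ ex _; apply: (exact_pair_norm _ (ex k)).
  by apply: leq_trans (dependent_ge k dep).
pose w k := eval00 g (z k) - s * (c <= k < e)%N%:R.
have -> : eval00 g (\sum_(i <= k < b) (-1) ^+ k *: z k) =
    s * \sum_(i <= k < b) (-1) ^+ k * (c <= k < e)%N%:R +
    \sum_(i <= k < b) (-1) ^+ k * w k.
  rewrite (eval_sumr _ _ bg) mulr_sumr -big_split; apply: eq_bigr => k _.
  by rewrite /w (evalZr _ _ bg) /=; lra.
rewrite (le_trans (ler_normD _ _))//.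
have h1 : `|s * \sum_(i <= k < b) (-1) ^+ k * (c <= k < e)%N%:R| <= 1.
  by rewrite normrM -[leRHS]mul1r ler_pM// alternating_sum.
have sgn k (y : R) : `|(-1) ^+ k * y| = `|y| by rewrite normrM normrX normrN1 expr1n mul1r.
have h2 : `|\sum_(i <= k < b) (-1) ^+ k * w k| <= 26 / (n j)%:R * (b - i)%:R + 18 * (size E)%:R.
  apply: sum_exceptions => //; rewrite ?divr_ge0//.
    by move=> k kE; rewrite sgn hE.
  move=> k; rewrite sgn /w (le_trans (ler_normB _ _))// (_ : 18 = 17 + 1); last lra.
  rewrite lerD// normrM -[leRHS]mul1r ler_pM//.
  by case: (_ && _); rewrite ?normr1 ?normr0.
have h3 : (size E)%:R <= 5 :> R by rewrite ler_nat.
lra.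
Qed.

Lemma index_lt j : (1 <= j)%N -> (j < (n j).+1.*2)%N.
Proof.
move=> j1; have h : (j <= n j)%N.
  case: j j1 => // i _; elim: i => [|i IH]; first by apply: leq_trans (n_ge3 hmn _).
  have [s [-> hs]] := n_step hmn (i := i.+1) isT.
  have n3 := n_ge3 hmn (i := i.+1) isT.
  have s2 : (2 <= s)%N.
    rewrite leqNgt; apply/negP => s1; have : (2 ^ s <= 2 ^ 1)%N by rewrite leq_exp2l.
    have h8 : (2 ^ 3 <= m i.+2 ^ 3)%N by rewrite leq_exp2r// (m_ge2 hmn).
    by move: (leq_trans h8 (ltnW hs)) => h1 /(leq_trans h1).
  apply: leq_trans (leq_pexp2l _ s2); last by apply: leq_trans n3.
  by rewrite expnS expn1; move: IH n3; clear; nia.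
by rewrite -addnn addSn ltnS (leq_trans h)// leq_addr.
Qed.

(** The indices of the z_k are distinct, so at most one of them is the weight of g. *)
Lemma large_weight_sum j i0 a z f v g i b : (1 <= j < i0)%N -> dependent j a z f v ->
  Lweight i0 g -> (i <= b)%N ->
  `|eval00 g (\sum_(i <= k < b) (-1) ^+ k *: z k)| <= 26 / (m j.+1)%:R * (b - i)%:R + 91.
Proof.
move=> /andP[j1 ji0] dep Lg ib; have LZg : LZ g by left; exact: Lweight_L Lg.
have bg := bLZ LZg; have [ainc bz bf ex _] := dep.
have jn := index_lt j1.
have [k0 hk0] : exists k0, forall k, k <> k0 -> i0 <> v k.
  case: (pselect (exists k, i0 = v k)) => [[k0 e]|nk]; last first.
    by exists 0%N => k _ e; apply: nk; exists k.
  exists k0 => k kk0; rewrite e => vk.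
  by have [/(dependent_mono dep)|/(dependent_mono dep)|/esym//] := ltngtP k0 k; rewrite vk ltnn.
have sgn k (y : R) : `|(-1) ^+ k * y| = `|y| by rewrite normrM normrX normrN1 expr1n mul1r.
rewrite (eval_sumr _ _ bg) (@le_trans _ _ (26 / (m j.+1)%:R * (b - i)%:R + 17))//; last first.
  by rewrite lerD2l ler_nat.
apply: (sum_one_exception (k0 := k0)) => //; rewrite ?divr_ge0//.
  move=> k kk0; rewrite (evalZr _ _ bg) sgn; apply: (exact_pair_eval (i := i0) (ex k)) => //.
  - exact: leq_trans jn (dependent_ge k dep).
  - exact: hk0.
  - exact: (Lweight_waverages hF).
move=> k; rewrite (evalZr _ _ bg) sgn (le_trans (eval_le hF hZ _ LZg))//.
by apply: (exact_pair_norm _ (ex k)); apply: leq_trans (dependent_ge k dep).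
Qed.

(** Choice of the constants for the conclusion: with c m_j of the order of 2^l and
    m_j at least 2 c^2, every term of the upper estimate is n_j / (c m_j) up to
    a numerical factor. *)
Lemma dependent_alternating j a z f v (c : nat) : odd j -> (2 <= j)%N -> (1 <= c)%N ->
  (2 * c ^ 2 <= m j)%N -> dependent j a z f v ->
  N (\sum_(0 <= k < n j) (-1) ^+ k *: z k) <= 134 / c%:R * ((n j)%:R / (m j)%:R).
Proof.
move=> oj j2 c1 cm dep; have [ainc bz bf ex _] := dep.
have j1 : (1 <= j)%N by exact: ltnW.
have jm1 : (1 <= j.-1)%N by case: j j2 {oj cm dep ex j1} => [|[]].
have [s [nj ms]] := n_step hmn jm1; rewrite prednK// in nj ms.
pose M := n j.-1; have M3 : (3 <= M)%N by exact: n_ge3 hmn _ jm1.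
have M1 : (1 <= M)%N by apply: leq_trans M3.
have m2 := m_ge2 hmn j1; have mj0 : (0 < m j)%N by apply: leq_trans m2.
have cm0 : (0 < c * m j)%N by rewrite muln_gt0 c1.
have m0 : 0 < (m j)%:R :> R by rewrite ltr0n.
have c0 : 0 < c%:R :> R by rewrite ltr0n.
have nj3 := n_ge3 hmn j1; have nj0 : (0 < n j)%N by apply: leq_trans nj3.
have n0 : 0 < (n j)%:R :> R by rewrite ltr0n.
have [l /andP[l1 l2]] := pow2_between cm0.
have small : (c * m j * M ^ l <= n j)%N.
  rewrite nj; apply: pow_transfer => //; first by apply: leq_trans M3.
  apply: leq_trans (ltnW ms); apply: (@leq_trans (c * m j * (2 * (c * m j)))).
    by rewrite leq_mul2l ltnW ?orbT.
  have -> : (c * m j * (2 * (c * m j)) = 2 * c ^ 2 * m j ^ 2)%N.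
    by rewrite !expnS !expn0; clear; lia.
  by rewrite [(m j ^ 3)%N]expnS leq_mul2r cm orbT.
have cmj : (c * m j <= m j ^ 2)%N.
  rewrite expnS expn1 leq_mul2r; apply/orP; right; apply: leq_trans cm.
  by move: c1; clear; rewrite expnS expn1; nia.
have m2n : (m j ^ 2 <= n j)%N.
  rewrite nj; apply: (@leq_trans (2 ^ s)%N).
    by apply: leq_trans (ltnW ms); rewrite leq_pexp2l.
  by case: (s) => // s'; rewrite leq_exp2r//; apply: leq_trans M3.
have m2m : (m j ^ 2 <= m j.+1)%N.
  by apply: leq_trans (mS5 hmn j1); rewrite leq_pexp2l.
pose d : R := 26 / (m j ^ 2)%:R.
have d0 : 0 <= d by rewrite divr_ge0.
have dle q : (m j ^ 2 <= q)%N -> 26 / q%:R <= d.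
  have h : (0 < m j ^ 2)%N by rewrite expn_gt0 mj0.
  by move=> mq; rewrite ler_pM2l// lef_pV2 ?posrE ?ltr0n ?ler_nat// (leq_trans h).
pose u k := (-1) ^+ k *: z k.
have bu : blocks a u by case: bz => h1 h2; split=> // k; exact: supp_inZ.
have flu k : flat M 17 (u k).
  have [_ _ _ fl _] := ex k.
  apply: flat_sub (flat_scale hmn hF ((-1) ^+ k) fl).
    apply: (n_mono hmn); rewrite jm1 /=.
    have vj := ltnW (leq_trans (index_lt j1) (dependent_ge k dep)).
    by case: (j) (v k) vj => [|j'] [|v'].
  by rewrite normrX normrN1 expr1n mul1r.
have C17 : 0 <= (17 : R) <= 91 by rewrite ler0n ler_nat.
have up g : LZ g -> `|eval00 g (\sum_(0 <= k < n j) u k)| <=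
    (17 / 2 ^+ l + d) * (n j - 0)%:R + 91 * M%:R ^+ l.
  move=> Lg; apply: (iterated_cut hmn hF (j0 := j) bu flu M1 C17 d0) => //.
    by move=> i /andP[i1 ij]; apply: (n_mono hmn); rewrite i1 /= -ltnS prednK.
  move=> h Lh; case: (L_cases Lh) => [Fh|[i [i1 Li]]]; first by constructor 1.
  have [ij|ji|ij] := ltngtP i j.
  - by constructor 2; exists i; rewrite i1; split=> //; exact: (Lweight_waverages hF).
  - constructor 3 => c' e ce.
    have j1i : (1 <= j < i)%N by rewrite j1.
    rewrite (le_trans (large_weight_sum j1i dep Li ce))// lerD2r ler_wpM2r// dle//.
  - constructor 3 => c' e ce; rewrite ij in Li.
    by rewrite (le_trans (special_sum oj dep Li ce))// lerD2r ler_wpM2r// dle.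
have w0 : 0 <= (c%:R * (m j)%:R)^-1 :> R by rewrite invr_ge0 mulr_ge0.
have b1 : 17 / 2 ^+ l <= 17 * (c%:R * (m j)%:R)^-1 :> R.
  by rewrite ler_pM2l// lef_pV2 ?posrE ?mulr_gt0 ?exprn_gt0// -natrM -natrX ler_nat.
have b2 : d <= 26 * (c%:R * (m j)%:R)^-1.
  rewrite /d ler_pM2l// -natrM lef_pV2 ?posrE ?ltr0n ?ler_nat//.
  by rewrite (leq_trans cm0).
have b3 : M%:R ^+ l <= (c%:R * (m j)%:R)^-1 * (n j)%:R :> R.
  by rewrite ler_pdivlMl ?mulr_gt0// -natrX -!natrM ler_nat.
apply: (norm_le hZ) => g Lg; rewrite (le_trans (ler_norm _))//.
rewrite (le_trans (up g (or_introl Lg)))// subn0.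
have b4 : (17 / 2 ^+ l + d) * (n j)%:R <= 43 * (c%:R * (m j)%:R)^-1 * (n j)%:R.
  by rewrite ler_wpM2r//; lra.
have -> : 134 / c%:R * ((n j)%:R / (m j)%:R) = 134 * ((c%:R * (m j)%:R)^-1 * (n j)%:R) :> R.
  by rewrite invfM; lra.
lra.
Qed.

(** The even terms of a dependent sequence are taken in one subspace and the odd terms
    in the other: the sum of the two partial sums is normed by a special
    functional, their difference is an alternating sum. *)
Lemma rich_HI U1 U2 (eps : R) : rich U1 -> rich U2 -> 0 < eps ->
  exists z1 z2, [/\ U1 z1, U2 z2 & N (z1 - z2) < eps * N (z1 + z2)].
Proof.
move=> rU1 rU2 e0; pose c := (Num.bound (134 / eps)).+1.
have hc : 134 / c%:R < eps.
  rewrite ltr_pdivrMr ?ltr0n// mulrC -ltr_pdivrMr//.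
  by rewrite (lt_trans (archi_boundP _)) ?divr_ge0 ?ltW// ltr_nat.
(* odd, and with m_j >= 2^j >= 2 c^2 *)
pose j := (2 * c ^ 2).*2.+1.
have c2 : (1 <= 2 * c ^ 2)%N by rewrite muln_gt0 expn_gt0.
have j2 : (2 <= j)%N by rewrite /j ltnS double_gt0.
have oj : odd j by rewrite /j /= odd_double.
have cm : (2 * c ^ 2 <= m j)%N.
  apply: leq_trans (m_exp hmn (ltnW j2)); apply: leq_trans (ltnW (ltn_expl _ _)) => //.
  by rewrite /j -addnn -addSn leq_addl.
have [k|a [z [f [v [dep Uz]]]]] :=
  exists_dependent hmn hF hsigma hZ (U := fun k => if odd k then U2 else U1) j.
  by case: ifP.
exists (\sum_(0 <= k < n j) (if odd k then 0 else z k)).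
exists (\sum_(0 <= k < n j) (if odd k then z k else 0)); split.
- apply: rich_sum => // k; have := Uz k; case: ifP => // _ _; exact: rich0.
- apply: rich_sum => // k; have := Uz k; case: ifP => // _ _; exact: rich0.
rewrite -sumrB -big_split /= (eq_bigr (fun k => (-1) ^+ k *: z k)); last first.
  by move=> k _; rewrite -signr_odd; case: (odd k); rewrite ?expr1 ?expr0 ?scaleN1r ?scale1r ?sub0r ?subr0.
rewrite [X in _ < _ * `|iota X|](eq_bigr z); last first.
  by move=> k _; case: (odd k); rewrite ?add0r ?addr0.
have nj3 := n_ge3 hmn (ltnW j2); have m2 := m_ge2 hmn (ltnW j2).
have q0 : 0 < (n j)%:R / (m j)%:R :> R by rewrite divr_gt0// ltr0n; [exact: leq_trans nj3|exact: leq_trans m2].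
apply: (le_lt_trans (dependent_alternating oj j2 _ cm dep)) => //.
apply: (@lt_le_trans _ _ (eps * ((n j)%:R / (m j)%:R))); first by rewrite ltr_pM2r.
by rewrite ler_pM2l// (dependent_norm hmn hF hZ oj dep).
Qed.

End Core.

(** * From subspaces of the completion to finitely supported vectors *)

Section Subspaces.
Context {R : realType} {V : normedModType R}.
Implicit Types (Y A : set V) (r : V -> R).

Lemma span_subspace A : subspaceV (linear_span A).
Proof.
split=> [M [[M0 _] _]//|a u v Au Av M MA]; have [[_ Ml] _] := MA.
by apply: Ml; [exact: Au|exact: Av].
Qed.

Lemma subspaceZ Y (a : R) y : subspaceV Y -> Y y -> Y (a *: y).
Proof. by move=> [Y0 Yl] Yy; rewrite -(addr0 (a *: y)); exact: Yl. Qed.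

Lemma subspace_sum Y (I : Type) (s : seq I) (u : I -> V) :
  subspaceV Y -> (forall i, Y (u i)) -> Y (\sum_(i <- s) u i).
Proof.
move=> [Y0 Yl] Yu; elim/big_ind: _ => // x y Yx Yy.
by rewrite -(scale1r x); exact: Yl.
Qed.

Lemma not_fin_dim_neq0 Y : subspaceV Y -> ~ finite_dimensional Y ->
  exists2 y, Y y & y <> 0.
Proof.
move=> [Y0 Yl] nf; apply: contrapT => h; apply: nf; exists [::].
apply/seteqP; split=> [y Yy|].
  have [->|/eqP y0] := eqVneq y 0; first exact: (span_subspace _).1.
  by exfalso; apply: h; exists y.
by apply: smallest_sub => // y.
Qed.

Definition ker_in r Y := Y `&` [set y | r y = 0].

(** The kernel of a functional has codimension at most 1 in Y. *)
Lemma ker_not_fin_dim r Y : (forall a u v, r (a *: u + v) = a * r u + r v) ->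
  subspaceV Y -> ~ finite_dimensional Y ->
  subspaceV (ker_in r Y) /\ ~ finite_dimensional (ker_in r Y).
Proof.
move=> rl sY nf; have [Y0 Yl] := sY.
have r0 : r 0 = 0 by have := rl 1 0 0; rewrite scaler0 addr0; lra.
have sK : subspaceV (ker_in r Y).
  split; first by split.
  move=> a u v [Yu ru] [Yv rv]; split; first exact: Yl.
  by rewrite /= rl ru rv mulr0 addr0.
split=> // -[s sE]; apply: nf.
case: (pselect (exists2 y, Y y & r y <> 0)) => [[y0 Yy0 ry0]|h]; last first.
  exists s; rewrite -sE; apply/seteqP; split=> [y Yy|y []//]; split=> //.
  by apply: contrapT => ry; apply: h; exists y.
exists (y0 :: s); apply/seteqP; split=> [y Yy|].
  pose w := y - (r y / r y0) *: y0.
  have Kw : ker_in r Y w.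
    have wE : w = - (r y / r y0) *: y0 + y by rewrite /w scaleNr addrC.
    split; first by rewrite wE; exact: Yl.
    rewrite /= wE rl mulNr divfK ?addNr//; exact/eqP.
  have yE : y = (r y / r y0) *: y0 + w by rewrite /w addrC subrK.
  rewrite yE; apply: (span_subspace _).2.
    by apply: sub_gen_smallest; rewrite /= mem_head.
  move: Kw; rewrite sE; apply: sub_smallest2r; first exact: span_subspace.
  by move=> v /= vs; rewrite inE vs orbT.
apply: smallest_sub => // v /=; rewrite inE => /orP[/eqP ->//|vs].
have : ker_in r Y v by rewrite sE; exact: sub_gen_smallest.
by case.
Qed.

Lemma common_kernel (r : nat -> V -> R) Y K :
  (forall k a u v, r k (a *: u + v) = a * r k u + r k v) ->
  subspaceV Y -> ~ finite_dimensional Y ->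
  exists y, [/\ Y y, y <> 0 & forall k, (k < K)%N -> r k y = 0].
Proof.
move=> rl; elim: K Y => [|K IH] Y sY nY.
  by have [y Yy y0] := not_fin_dim_neq0 sY nY; exists y.
have [sK nK] := ker_not_fin_dim (rl K) sY nY.
have [y [[Yy ry] y0 hy]] := IH _ sK nK; exists y; split=> // k.
by rewrite ltnS leq_eqVlt => /orP[/eqP ->//|]; exact: hy.
Qed.

End Subspaces.

Section Gliding.
Context {R : realType} {X : nat -> completeNormedModType R}.
Context {m n : nat -> nat} {F : forall k, set (X k -> R^o)}.
Context {sigma : seq (functional X) -> nat}.
Context {Z : completeNormedModType R} {iota : {linear Omega00 X -> Z}}.
Hypotheses (hmn : parameters m n) (hF : forall k, norming_set (@F k)).
Hypothesis hsigma : coding m n F sigma.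
Hypothesis hZ : is_d_product m n F sigma iota.
Implicit Types (f g h : functional X).
Implicit Type U : set (Omega00 X).

Notation L := (Lset m n F sigma).
Notation LZ := (withzero L).
Local Notation N x := `|iota x|.

Let Lball f (h : L f) : dual_ball00 f := LZ_ball hmn hF (or_introl h).

Lemma approximation (z : Z) (e : R) : 0 < e -> exists x, `|z - iota x| < e.
Proof.
move=> e0; have [_ /(_ (ball z e))[||y [zy [x _ xy]]]] := hZ.
- by exists z; exact: ballxx.
- by apply: ball_open.
by exists x; rewrite xy; move: zy; rewrite -ball_normE.
Qed.

(** The extension by continuity of f, which is 1-Lipschitz, to the completion;
    the inequality characterizes its value since the range is dense. *)
Lemma extension f : L f -> exists r : Z -> R,
  (forall z x, `|r z - eval00 f x| <= `|z - iota x|) /\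
  forall a u v, r (a *: u + v) = a * r u + r v.
Proof.
move=> Lf; have fl x y : eval00 f x - eval00 f y <= `|iota x - iota y|.
  rewrite -linearB (le_trans _ (eval_le hF hZ _ (or_introl Lf)))//.
  by rewrite (evalDr _ _ (Lball Lf)) (evalNr _ (Lball Lf)) ler_norm.
have hr z : exists r : R, forall x, `|r - eval00 f x| <= `|z - iota x|.
  (* the least 1-Lipschitz extension *)
  pose S := [set eval00 f x - `|z - iota x| | x in setT].
  have ubS y : ubound S (eval00 f y + `|z - iota y|).
    move=> _ [x _ <-]; have := fl x y.
    have := ler_distD z (iota x) (iota y); rewrite [`|iota x - z|]distrC; lra.
  exists (sup S) => x; rewrite ler_distl; apply/andP; split.
    by apply: ub_le_sup; [exists (eval00 f 0 + `|z - iota 0|); exact: ubS|exists x].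
  by apply: ge_sup => //; exists (eval00 f 0 - `|z - iota 0|); exists 0.
have [r hr'] := choice hr; exists r; split=> // a u v.
apply/eqP; rewrite -subr_eq0 -normr_le0; apply/ler_addgt0Pr => e e0; rewrite add0r.
pose d := e / (2 * (`|a| + 1)).
have a0 : 0 < 2 * (`|a| + 1) by rewrite mulr_gt0// ltr_wpDl.
have d0 : 0 < d by rewrite divr_gt0.
have [x xu] := approximation u d0; have [y yv] := approximation v d0.
have e1 : `|r (a *: u + v) - eval00 f (a *: x + y)| <= `|a| * d + d.
  rewrite (le_trans (hr' _ _))// linearP opprD addrACA -scalerBr.
  rewrite (le_trans (ler_normD _ _))// normrZ lerD//; last exact: ltW.
  by rewrite ler_wpM2l// ltW.
have e2 : `|a * (r u - eval00 f x)| <= `|a| * d.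
  by rewrite normrM ler_wpM2l// (le_trans (hr' _ _))// ltW.
have e3 : `|r v - eval00 f y| <= d by rewrite (le_trans (hr' _ _))// ltW.
rewrite (evalPr _ _ _ (Lball Lf)) in e1.
have ed : e = 2 * (`|a| * d + d).
  rewrite -[X in _ + X]mul1r -mulrDl mulrA mulrC /d divfK//; exact: lt0r_neq0.
move: e1 e2 e3; rewrite !ler_norml ed => /andP[? ?] /andP[? ?] /andP[? ?].
by apply/andP; split; lra.
Qed.

Lemma block_windows (x : nat -> Omega00 X) : block_sequence x ->
  exists a, (forall k, (a k < a k.+1)%N) /\ blocks a x.
Proof.
move=> bx; have hk k : exists q, x k q <> 0 /\ forall q', (q' < q)%N -> x k q' = 0.
  pose P := [pred q | x k q != 0].
  have exP : exists q, P q by have [q xq] := nz_supp (bx k).1; exists q.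
  case: (ex_minnP exP) => q xq qm; exists q; split; first exact/eqP.
  by move=> q' qq; apply/eqP; apply: contraTT qq => h; rewrite -leqNgt qm.
have [a ha] := choice hk; exists a.
have ainc k : (a k < a k.+1)%N.
  have [_ /supp_ltP h] := bx k; apply: h; [exact: (ha k).1|exact: (ha k.+1).1].
split=> //; split=> [k|k q]; first exact: ltnW.
case/orP => [|aq]; first exact: (ha k).2.
apply: contrapT => xq; have [_ /supp_ltP h] := bx k.
by have := h _ _ xq (ha k.+1).1; rewrite ltnNge aq.
Qed.

(** Gliding hump: an infinite dimensional subspace Y of a block subspace contains
    nonzero vectors on which any given finitely many coordinates vanish; such a
    vector is close to combinations of the remaining terms of the sequence. *)
Lemma gliding_hump (x : nat -> Omega00 X) (Y : set Z) : block_sequence x ->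
  subspaceV Y -> Y `<=` block_subspace iota x -> ~ finite_dimensional Y ->
  forall p (d : R), 0 < d -> exists (u : Omega00 X) (y : Z),
    [/\ u <> 0, (forall k, (k < p)%N -> u k = 0), Y y & `|y - iota u| <= d * N u].
Proof.
move=> bx sY YW nY p d d0; have [a [ainc ba]] := block_windows bx.
have ak k : (k <= a k)%N by elim: k => // k IH; apply: leq_ltn_trans (ainc k).
have hf k : exists f, [/\ L f, 0 < eval00 f (x k) & forall l, l <> k -> eval00 f (x l) = 0].
  have [q /eqP xq] := nz_supp (bx k).1.
  have [f Ff [fx f0]] := coord_functional hF xq; exists f; split=> //; first exact: L_F_all.
  move=> l lk; apply: f0; apply: contrapT => xl; apply: lk.
  exact: (blocks_index ba ba xl xq).
have [f hf'] := choice hf; have Lf k : L (f k) by case: (hf' k).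
have fb k := Lball (Lf k).
have [r hr] := choice (fun k => extension (Lf k)).
have [|y [Yy y0 ry]] := common_kernel (r := r) p _ sY nY; first by move=> k; exact: (hr k).2.
pose head w := \sum_(0 <= k < p) (eval00 (f k) w / eval00 (f k) (x k)) *: x k.
have headP c v w : head (c *: v + w) = c *: head v + head w.
  rewrite /head scaler_sumr -big_split; apply: eq_bigr => k _ /=.
  by rewrite (evalPr _ _ _ (fb k)) scalerA -scalerDl mulrDl mulrA.
(* the identity defining Q is linear in w: it holds on the span once it does for x_l *)
pose Q : set Z := [set z | exists2 w, z = iota w & w - tail (a p) w = head w].
have Qspan : linear_span (range (iota \o x)) `<=` Q.
  apply: smallest_sub; last first.
    move=> _ [l _ <-]; exists (x l) => //; rewrite /head.
    have [lp|pl] := ltnP l p.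
      rewrite (@tailE0 _ _ (a l) (a l.+1)) ?subr0; last 2 first.
      - by case: ba.
      - exact: blocks_mono ba lp.
      have li : l \in index_iota 0 p by rewrite mem_index_iota.
      rewrite (bigD1_seq l li) ?iota_uniq//= divff ?scale1r; last first.
        by have [_ h _] := hf' l; rewrite gt_eqF.
      rewrite big1 ?addr0// => k /eqP kl; have [_ _ ->] := hf' k; first by rewrite mul0r scale0r.
      by move=> e; apply: kl.
    rewrite tail_id ?subrr; last first.
      move=> k kp; case: (ba) => _ /(_ l k); apply; apply/orP; left.
      exact: leq_trans kp (blocks_mono ba pl).
    rewrite big_nat big1// => k /andP[_ kp]; have [_ _ ->] := hf' k; first by rewrite mul0r scale0r.
    by move=> e; move: kp; rewrite -e ltnNge pl.
  split.
    exists 0; first by rewrite linear0.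
    rewrite tail_0 subr0 /head big1// => k _.
    by rewrite (eval0r (fb k)) mul0r scale0r.
  move=> c _ _ [v -> hv] [w -> hw]; exists (c *: v + w); first by rewrite linearP.
  by rewrite headP -hv -hw tailD tailZ scalerBr opprD addrACA.
pose C := \sum_(0 <= k < p) (N (x k) / eval00 (f k) (x k)).
have C0 : 0 <= C.
  by apply: sumr_ge0 => k _; have [_ h _] := hf' k; rewrite divr_ge0// ltW.
have yn : 0 < `|y| by rewrite normr_gt0; exact/eqP.
(* the solution of d' = d (|y| - d') *)
pose d' := `|y| * d / (1 + d).
have d1 : 0 < 1 + d by lra.
have d'0 : 0 < d' by rewrite divr_gt0// mulr_gt0.
pose e := d' / (1 + C).
have C1 : 0 < 1 + C by lra.
have e0 : 0 < e by rewrite divr_gt0.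
have [z [zs yz]] : exists z, linear_span (range (iota \o x)) z /\ `|y - z| < e.
  have [z [zs bz]] := YW y Yy (ball y e) (nbhsx_ballx _ _ e0).
  by exists z; split=> //; move: bz; rewrite -ball_normE.
have [w zw hw] := Qspan z zs.
have fw k : (k < p)%N -> `|eval00 (f k) w| <= e.
  move=> kp; have := (hr k).1 y w; rewrite (ry k kp) sub0r normrN -zw => h.
  by rewrite (le_trans h)// ltW.
have hN : N (head w) <= e * C.
  rewrite /head linear_sum (le_trans (ler_norm_sum _ _ _))// mulr_sumr.
  apply: ler_sum_nat => k /= kp; have [_ h _] := hf' k.
  rewrite linearZ normrZ normrM [`|_^-1|]gtr0_norm ?invr_gt0//.
  by rewrite -mulrA [_^-1 * _]mulrC ler_wpM2r ?fw// divr_ge0// ltW.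
pose u := tail (a p) w.
have wu : iota w - iota u = iota (head w) by rewrite -linearB hw.
have yu : `|y - iota u| <= d'.
  have -> : y - iota u = (y - z) + iota (head w) by rewrite -wu zw addrA subrK.
  rewrite (le_trans (ler_normD _ _))// (_ : d' = e + e * C); last first.
    by rewrite -{1}[e]mulr1 -mulrDr /e divfK// gt_eqF.
  by rewrite lerD// ltW.
have Nu : `|y| - d' <= N u.
  have := ler_normD (y - iota u) (iota u); rewrite subrK; lra.
have dN : d' = d * (`|y| - d').
  have : d' * (1 + d) = `|y| * d by rewrite /d' divfK// gt_eqF.
  lra.
have Nu0 : 0 < N u.
  by rewrite (lt_le_trans _ Nu)// -(pmulr_rgt0 _ d0) -dN.
exists u, y; split=> //.
- by move=> u0; move: Nu0; rewrite u0 linear0 normr0 ltxx.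
- by move=> k kp; rewrite /u tailE (leq_trans kp (ak p)).
- by rewrite (le_trans yu)// {1}dN ler_wpM2l// ltW.
Qed.

(** A rich subspace uniformly close to Y: the sizes of the perturbations of the
    successive basis vectors are summable, and the coefficients of z are
    controlled by its norm because tails have norm at most that of z. *)
Lemma rich_approximation (x : nat -> Omega00 X) (Y : set Z) (e : R) : block_sequence x ->
  subspaceV Y -> Y `<=` block_subspace iota x -> ~ finite_dimensional Y -> 0 < e ->
  exists2 U, rich U & forall z, U z -> exists2 y, Y y & `|y - iota z| <= e * N z.
Proof.
move=> bx sY YW nY e0.
pose P (hist : seq (Omega00 X * Z)) p (uy : Omega00 X * Z) q :=
  [/\ uy.1 <> 0, (p < q)%N, supp_in p q uy.1, Y uy.2 &
    `|uy.2 - iota uy.1| <= e / 4 / 2 ^+ (size hist) * N uy.1].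
have [hist p|uy [a [_ huy]]] := @block_choice _ P 0%N.
  have [|u [y [u0 up Yy yu]]] := gliding_hump bx sY YW nY p (d := e / 4 / 2 ^+ (size hist)).
    by rewrite !divr_gt0// exprn_gt0.
  by have [q pq w] := exists_supp_in up; exists (u, y), q.
pose u k := (uy k).1; pose y k := (uy k).2.
have ainc k : (a k < a k.+1)%N by case: (huy k).
have bu : blocks a u by split=> k; [exact: ltnW|case: (huy k)].
have ak k : (k <= a k)%N by elim: k => // k IH; apply: leq_ltn_trans (ainc k).
have yu k : `|y k - iota (u k)| <= e / 4 / 2 ^+ k * N (u k).
  by case: (huy k); rewrite size_mkseq.
pose comb (c : nat -> R) K := \sum_(0 <= k < K) c k *: u k.
exists [set z | exists c K, (forall k, (K <= k)%N -> c k = 0) /\ z = comb c K].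
  have extend c K K' : (forall k, (K <= k)%N -> c k = 0) -> (K <= K')%N ->
      comb c K = comb c K'.
    move=> c0 KK; have tl : \sum_(K <= k < K') c k *: u k = 0.
      by rewrite big_nat big1// => k /andP[Kk _]; rewrite c0// scale0r.
    by rewrite /comb (@big_cat_nat _ _ _ K 0 K')//= tl addr0.
  split.
    move=> b _ _ [c [K [cK ->]]] [c' [K' [cK' ->]]].
    exists (fun k => b * c k + c' k), (maxn K K'); split.
      by move=> k; rewrite geq_max => /andP[h h']; rewrite cK// cK'// mulr0 addr0.
    rewrite (extend c K (maxn K K'))// ?leq_maxl// (extend c' K' (maxn K K'))// ?leq_maxr//.
    rewrite /comb scaler_sumr -big_split; apply: eq_bigr => k _ /=.
    by rewrite scalerA scalerDl.
  move=> p; exists (u p); split.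
  - exists (fun k => (k == p)%:R), p.+1; split.
      by move=> k pk; case: eqP pk => // ->; rewrite ltnn.
    rewrite /comb big_nat_recr//= eqxx scale1r big_nat big1 ?add0r// => k /andP[_ kp].
    by rewrite ltn_eqF// scale0r.
  - by case: (huy p).
  - by move=> k kp; case: (bu) => _ /(_ p k); apply; rewrite (leq_trans kp (ak p)).
move=> _ [c [K [_ ->]]]; exists (\sum_(0 <= k < K) c k *: y k).
  apply: subspace_sum => // k; apply: subspaceZ => //.
  by case: (huy k).
set z := comb c K.
have coef k : (k < K)%N -> `|c k| * N (u k) <= 2 * N z.
  move=> kK; rewrite -normZ.
  have -> : c k *: u k = tail (a k) z - tail (a k.+1) z.
    rewrite /z /comb !tail_sum -sumrB.
    have ki : k \in index_iota 0 K by rewrite mem_index_iota.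
    rewrite (bigD1_seq k ki) ?iota_uniq//= big1 ?addr0 => [|l /eqP lk].
      rewrite !tailZ [tail (a k) _]tail_id; last first.
        by move=> q qa; case: (bu) => _ /(_ k q); apply; rewrite qa.
      by rewrite (@tailE0 _ _ (a k) (a k.+1)) ?scaler0 ?subr0//; case: bu.
    rewrite !tailZ -scalerBr; have [kl|lk'|kl] := ltngtP k l; last by case: lk.
      rewrite !tail_id ?subrr ?scaler0// => q qa; case: (bu) => _ /(_ l q); apply;
        apply/orP; left; apply: leq_trans qa _; apply: (blocks_mono bu) => //.
      exact: ltnW.
    have wl : supp_in (a l) (a l.+1) (u l) by case: bu.
    rewrite !(tailE0 wl) ?subrr ?scaler0//; last exact: (blocks_mono bu lk').
    by apply: (blocks_mono bu); exact: ltnW.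
  rewrite linearB (le_trans (ler_normB _ _))//.
  have := norm_tail hmn hF hZ (a k) z; have := norm_tail hmn hF hZ (a k.+1) z; lra.
have geo : \sum_(0 <= k < K) (2 ^+ k)^-1 <= 2 :> R.
  suff h K' : \sum_(0 <= k < K') (2 ^+ k)^-1 = 2 - 2 / 2 ^+ K' :> R.
    by rewrite h gerBl divr_ge0// exprn_ge0.
  elim: K' => [|K' IH]; first by rewrite big_geq// expr0 divr1 subrr.
  by rewrite big_nat_recr//= IH exprS invfM; lra.
have zE : iota z = \sum_(0 <= k < K) c k *: iota (u k).
  by rewrite linear_sum; apply: eq_bigr => k _; rewrite linearZ.
rewrite [X in _ - X]zE -sumrB (le_trans (ler_norm_sum _ _ _))//.
apply: (@le_trans _ _ (\sum_(0 <= k < K) e / 2 * N z * (2 ^+ k)^-1)).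
  apply: ler_sum_nat => k /= kK; rewrite -scalerBr normrZ.
  apply: (@le_trans _ _ (`|c k| * (e / 4 / 2 ^+ k * N (u k)))); first by rewrite ler_wpM2l.
  have s0 : 0 <= e / 4 * (2 ^+ k)^-1 by rewrite mulr_ge0// ?invr_ge0 ?exprn_ge0// divr_ge0// ltW.
  have := ler_wpM2l s0 (coef k kK); lra.
rewrite -mulr_sumr; apply: (@le_trans _ _ (e / 2 * N z * 2)); last lra.
by rewrite ler_wpM2l// mulr_ge0// divr_ge0// ltW.
Qed.

End Gliding.

Theorem theorem6p2 (R : realType) (X : nat -> completeNormedModType R)
    (hX : forall k, separable (X k))
    (m n : nat -> nat) (hmn : parameters m n)
    (F : forall k, set (X k -> R^o)) (hF : forall k, norming_set (F k))
    (sigma : seq (functional X) -> nat) (hsigma : coding m n F sigma)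
    (Z : completeNormedModType R) (iota : {linear Omega00 X -> Z})
    (hZ : is_d_product m n F sigma iota) :
  block_HI iota.
Proof.
move=> x bx Y1 Y2 sY1 _ YW1 nY1 sY2 _ YW2 nY2 eps eps0.
pose e := Num.min eps 1.
have e0 : 0 < e by rewrite lt_min eps0 ltr01.
have e1 : e <= 1 by rewrite ge_min lexx orbT.
have ee : e <= eps by rewrite ge_min lexx.
have e16 : 0 < e / 16 by rewrite divr_gt0.
have [U1 rU1 h1] := rich_approximation hmn hF hZ bx sY1 YW1 nY1 e16.
have [U2 rU2 h2] := rich_approximation hmn hF hZ bx sY2 YW2 nY2 e16.
have e4 : 0 < e / 4 by rewrite divr_gt0.
have [z1 [z2 [Uz1 Uz2 hz]]] := rich_HI hmn hF hsigma hZ rU1 rU2 e4.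
have [y1 Yy1 d1] := h1 z1 Uz1; have [y2 Yy2 d2] := h2 z2 Uz2.
exists y1, y2; split=> //.
set S := `|iota (z1 + z2)| in hz; set D := `|iota (z1 - z2)| in hz.
have S0 : 0 < S.
  by rewrite -(pmulr_rgt0 _ e4) (le_lt_trans _ hz)// normr_ge0.
have DS : D <= S by rewrite (le_trans (ltW hz))// ler_piMl ?ltW//; lra.
have n1 : `|iota z1| <= S.
  have := ler_normD (iota (z1 + z2)) (iota (z1 - z2)).
  have -> : iota (z1 + z2) + iota (z1 - z2) = 2 *: iota z1.
    by rewrite -linearD addrACA subrr addr0 -mulr2n -scaler_nat linearZ.
  by rewrite normrZ ger0_norm// -/S -/D; lra.
have n2 : `|iota z2| <= S.
  have := ler_normB (iota (z1 + z2)) (iota (z1 - z2)).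
  have -> : iota (z1 + z2) - iota (z1 - z2) = 2 *: iota z2.
    by rewrite -linearB opprB addrC addrA subrK -mulr2n -scaler_nat linearZ.
  by rewrite normrZ ger0_norm// -/S -/D; lra.
have {}d1 : `|y1 - iota z1| <= e / 16 * S by rewrite (le_trans d1)// ler_wpM2l// ltW.
have {}d2 : `|y2 - iota z2| <= e / 16 * S by rewrite (le_trans d2)// ler_wpM2l// ltW.
have a1 : `|y1 - y2| <= D + e / 8 * S.
  have -> : y1 - y2 = iota (z1 - z2) + ((y1 - iota z1) - (y2 - iota z2)).
    by rewrite linearB opprB addrACA addKr [iota z1 + _]addrC subrK.
  rewrite (le_trans (ler_normD _ _))// -/D lerD2l (le_trans (ler_normB _ _))//; lra.
have a2 : S - e / 8 * S <= `|y1 + y2|.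
  have : S <= `|y1 + y2| + (`|y1 - iota z1| + `|y2 - iota z2|).
    have -> : S = `|(y1 + y2) - ((y1 - iota z1) + (y2 - iota z2))|.
      by rewrite [_ - iota z1 + _]addrACA -opprD subKr /S linearD.
    rewrite (le_trans (ler_normB _ _))// lerD2l; exact: ler_normD.
  lra.
apply: (@lt_le_trans _ _ (e * (S - e / 8 * S))).
  rewrite (le_lt_trans a1)//.
  have h : e * S <= S by rewrite ler_piMl// ltW.
  have := ler_wpM2l (ltW e0) h.
  have := mulr_gt0 e0 S0; lra.
rewrite (le_trans (ler_wpM2l (ltW e0) a2))// ler_wpM2r//.
Qed.
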